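(* Let $L,\mathfrak d\in\mathbb N$, $(\ell_k)_{k\in\mathbb N_0}\subseteq\mathbb N$, $a\in\mathbb R$, $b\in(a,\infty)$, $\xi\in\mathbb R^{\ell_L}$ satisfy $\mathfrak d=\sum_{k=1}^L\ell_k(\ell_{k-1}+1)$. For every $\theta=(\theta_1,\dots,\theta_{\mathfrak d})\in\mathbb R^{\mathfrak d}$, $k\in\{1,\dots,L\}$, $i\in\{1,\dots,\ell_k\}$, $j\in\{1,\dots,\ell_{k-1}\}$ let $\mathfrak w^{k,\theta}_{i,j}=\theta_{(i-1)\ell_{k-1}+j+\sum_{h=1}^{k-1}\ell_h(\ell_{h-1}+1)}$ and $\mathfrak b^{k,\theta}_i=\theta_{\ell_k\ell_{k-1}+i+\sum_{h=1}^{k-1}\ell_h(\ell_{h-1}+1)}$, let $\mathfrak w^{k,\theta}=(\mathfrak w^{k,\theta}_{i,j})_{(i,j)\in\{1,\dots,\ell_k\}\times\{1,\dots,\ell_{k-1}\}}\in\mathbb R^{\ell_k\times\ell_{k-1}}$, $\mathfrak b^{k,\theta}=(\mathfrak b^{k,\theta}_1,\dots,\mathfrak b^{k,\theta}_{\ell_k})\in\mathbb R^{\ell_k}$, and let $\mathcal A^\theta_k\colon\mathbb R^{\ell_{k-1}}\to\mathbb R^{\ell_k}$, $\mathcal A^\theta_k(x)=\mathfrak b^{k,\theta}+\mathfrak w^{k,\theta}x$. Let $\mathscr R_r\colon\mathbb R\to\mathbb R$, $r\in[1,\infty]$, satisfy $\mathscr R_\infty(y)=\max\{y,0\}$ for all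 $y\in\mathbb R$ and, for all $r\in[1,\infty)$, $x\in(-\infty,2^{-1}r^{-1}]$, $y\in\mathbb R$, $z\in[r^{-1},\infty)$: $\mathscr R_r\in C^1(\mathbb R,\mathbb R)$, $\mathscr R_r(x)=0$, $0\le\mathscr R_r(y)\le\max\{y,0\}$, and $\mathscr R_r(z)=z$; assume $\sup_{r\in[1,\infty)}\sup_{x\in\mathbb R}|(\mathscr R_r)'(x)|<\infty$. Let $\|\cdot\|$ denote the Euclidean norm on each $\mathbb R^n$ and, for $r\in[1,\infty]$, let $\mathfrak M_r(x_1,\dots,x_n)=(\mathscr R_r(x_1),\dots,\mathscr R_r(x_n))$. Let $(\Omega,\mathcal F,\mathbb P)$ be a probability space, let $X^{n,m}\colon\Omega\to[a,b]^{\ell_0}$, $n,m\in\mathbb N_0$, be i.i.d. random variables, and let $(M_n)_{n\in\mathbb N_0}\subseteq\mathbb N$. For $r\in[1,\infty]$ and $\theta\in\mathbb R^{\mathfrak d}$ define $\mathcal N^{k,\theta}_r\colon\mathbb R^{\ell_0}\to\mathbb R^{\ell_k}$, $k\in\{1,\dots,L\}$, by $\mathcal N^{1,\theta}_r=\mathcal A^\theta_1$ and $\mathcal N^{k+1,\theta}_r(x)=\mathcal A^\theta_{k+1}(\mathfrak M_{r^{1/k}}(\mathcal N^{k,\theta}_r(x)))$ (with $\infty^{1/k}=\infty$), and define $\mathfrak L^n_r\colon\mathbb R^{\mathfrak d}\times\Omega\to\mathbb R$, $n\in\mathbb N_0$, by $\mathfrak L^n_r(\theta,\omega)=\frac1{M_n}\sum_{m=1}^{M_n}\|\mathcal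 N^{L,\theta}_r(X^{n,m}(\omega))-\xi\|^2$. Let $\mathcal L\colon\mathbb R^{\mathfrak d}\to\mathbb R$, $\mathcal L(\theta)=\mathbb E[\|\mathcal N^{L,\theta}_\infty(X^{0,0})-\xi\|^2]$. For every $n\in\mathbb N_0$ let $\mathfrak G^n\colon\mathbb R^{\mathfrak d}\times\Omega\to\mathbb R^{\mathfrak d}$ satisfy $\mathfrak G^n(\theta,\omega)=\lim_{r\to\infty}(\nabla_\theta\mathfrak L^n_r)(\theta,\omega)$ for all $\theta\in\mathbb R^{\mathfrak d}$ and all $\omega$ for which $((\nabla_\theta\mathfrak L^n_r)(\theta,\omega))_{r\in[1,\infty)}$ is convergent as $r\to\infty$. Let $\Theta=(\Theta_n)_{n\in\mathbb N_0}\colon\mathbb N_0\times\Omega\to\mathbb R^{\mathfrak d}$ be a stochastic process and $(\gamma_n)_{n\in\mathbb N_0}\subseteq[0,\infty)$, assume that $\Theta_0$ and $(X^{n,m})_{(n,m)\in\mathbb N_0^2}$ are independent, and assume for all $n\in\mathbb N_0$, $\omega\in\Omega$ that $\Theta_{n+1}(\omega)=\Theta_n(\omega)-\gamma_n\mathfrak G^n(\Theta_n(\omega),\omega)$, that $(4L\mathfrak d\max\{|a|,|b|,\|\xi\|,1\})^{2L}\gamma_n\le(\|\Theta_0(\omega)\|+1)^{-2L}$, and that $\sum_{k=0}^\infty\gamma_k=\infty$. Then (i) there exists $\mathfrak C\in\mathbb R$ such that $\mathbb P(\sup_{n\in\mathbb N_0}\|\Theta_n\|\le\mathfrak C)=1$,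 (ii) $\mathbb P(\limsup_{n\to\infty}\mathcal L(\Theta_n)=0)=1$, and (iii) $\limsup_{n\to\infty}\mathbb E[\mathcal L(\Theta_n)]=0$.
   Context: $\mathbb N=\{1,2,3,\dots\}$, $\mathbb N_0=\mathbb N\cup\{0\}$. $\nabla_\theta$ denotes the gradient with respect to $\theta\in\mathbb R^{\mathfrak d}$. The vector $\xi$ represents the constant target function $[a,b]^{\ell_0}\ni x\mapsto\xi$. *)

(* Defs.v *)
From HB Require Import structures.
From mathcomp Require Import all_boot all_order all_algebra.
From mathcomp Require Import all_classical all_reals all_analysis.
Set Implicit Arguments. Unset Strict Implicit. Unset Printing Implicit Defensive.
Import Order.TTheory GRing.Theory Num.Theory.
Import numFieldNormedType.Exports.
Local Open Scope classical_set_scope.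
Local Open Scope ring_scope.

Section Defs.
Variable R : realType.

Definition enorm (n : nat) (v : 'cV[R]_n) : R :=
  Num.sqrt (\sum_(i < n) v i ord0 ^+ 2).

Definition vec_borel (n : nat) : set (set 'cV[R]_n) :=
  <<s \bigcup_(i in [set: 'I_n])
        preimage_set_system setT (fun x : 'cV[R]_n => x i ord0) measurable >>.

Context {d : measure_display} {T : measurableType d}.

Definition rvec_measurable (n : nat) (X : T -> 'cV[R]_n) : Prop :=
  forall B, vec_borel B -> measurable (X @^-1` B).

Definition sigma_rv (n : nat) (X : T -> 'cV[R]_n) : set (set T) :=
  [set A | exists2 B, vec_borel B & A = X @^-1` B].

Definition indep2 (P : probability T R) (F G : set (set T)) : Prop :=
  forall A B, F A -> G B -> P (A `&` B) = (P A * P B)%E.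

Definition mutually_indep {I : choiceType} (P : probability T R)
    (F : I -> set (set T)) : Prop :=
  forall (J : seq I) (E : I -> set T), uniq J ->
    (forall j, j \in J -> F j (E j)) ->
    P (\bigcap_(j in [set x | x \in J]) E j) = (\prod_(j <- J) P (E j))%E.

Definition iid {I : choiceType} (P : probability T R) (n : nat)
    (X : I -> T -> 'cV[R]_n) : Prop :=
  (forall i, rvec_measurable (X i)) /\
  mutually_indep P (fun i => sigma_rv (X i)) /\
  (forall i j B, vec_borel B -> P (X i @^-1` B) = P (X j @^-1` B)).

Definition sigma_family {I : Type} (n : nat) (X : I -> T -> 'cV[R]_n)
  : set (set T) := <<s \bigcup_(i in [set: I]) sigma_rv (X i) >>.

End Defs.

Section Network.
Variable R : realType.
Variable l : nat -> nat.
Variable dd : nat.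

(* theta_p with 0-based index p (0 outside the range, never used) *)
Definition thc (th : 'cV[R]_dd) (p : nat) : R :=
  match @insub nat (fun q => q < dd)%N _ p with
  | Some q => th q ord0 | None => 0 end.

Definition off (k : nat) : nat := (\sum_(1 <= h < k) l h * (l h.-1 + 1))%N.

(* w^{k,th}_{i,j} = th_{(i-1) l_{k-1} + j + off k} (1-based); 0-based below *)
Definition weight (k : nat) (th : 'cV[R]_dd) : 'M[R]_(l k, l k.-1) :=
  \matrix_(i, j) thc th (i * l k.-1 + j + off k)%N.

(* b^{k,th}_i = th_{l_k l_{k-1} + i + off k} (1-based); 0-based below *)
Definition bias (k : nat) (th : 'cV[R]_dd) : 'cV[R]_(l k) :=
  \col_i thc th (l k * l k.-1 + i + off k)%N.

Definition layer_aff (k : nat) (th : 'cV[R]_dd) (x : 'cV[R]_(l k.-1)) : 'cV[R]_(l k) :=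
  bias k th + weight k th *m x.

(* activation family R_r, r in [1, +oo] encoded as an extended real *)
Variable Rr : \bar R -> R -> R.

Definition act (r : \bar R) (n : nat) (x : 'cV[R]_n) : 'cV[R]_n :=
  map_mx (Rr r) x.

Definition eroot (r : \bar R) (k : nat) : \bar R :=
  match r with
  | EFin x => EFin (powR x (k%:R)^-1)
  | _ => r
  end.

(* N^{k,th}_r; N^0 = id is an auxiliary base case, N^1 = A_1,
   N^{k+1} = A_{k+1} o M_{r^{1/k}} o N^k for k >= 1 *)
Fixpoint net (r : \bar R) (th : 'cV[R]_dd) (k : nat)
  : 'cV[R]_(l 0) -> 'cV[R]_(l k) :=
  match k with
  | 0 => fun x => x
  | k'.+1 => fun x =>
      @layer_aff k'.+1 th (if k' == 0%N then net r th k' x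
                       else act (eroot r k') (net r th k' x))
  end.

Definition grad (f : 'cV[R]_dd -> R) (th : 'cV[R]_dd) : 'cV[R]_dd :=
  \col_i ('D_(delta_mx i ord0) f th).

End Network.
Arguments net {R} l {dd} Rr r th k x.

Section Losses.
Variables (R : realType) (l : nat -> nat) (dd : nat) (Rr : \bar R -> R -> R).
Variables (L : nat) (xi : 'cV[R]_(l L)).
Context {d : measure_display} {T : measurableType d}.

Definition emp_loss (M : nat -> nat) (X : nat -> nat -> T -> 'cV[R]_(l 0))
    (n : nat) (r : \bar R) (th : 'cV[R]_dd) (w : T) : R :=
  (M n)%:R^-1 *
    \sum_(m < M n) enorm (net l Rr r th L (X n m.+1 w) - xi) ^+ 2.

(* population loss  L(th) = E[|N^{L,th}_oo(X^{0,0}) - xi|^2]  (finite, as the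
   integrand is bounded; fine converts to R) *)
Definition pop_loss (P : probability T R) (X : nat -> nat -> T -> 'cV[R]_(l 0))
    (th : 'cV[R]_dd) : R :=
  fine ('E_P[fun w => enorm (net l Rr +oo%E th L (X 0%N 0%N w) - xi) ^+ 2]).
End Losses.

(* Main.v *)
Require Import Defs.
From HB Require Import structures.
From mathcomp Require Import all_boot all_order all_algebra.
From mathcomp Require Import all_classical all_reals all_analysis.
From mathcomp Require Import measurable_realfun ring lra zify.
Import Order.TTheory GRing.Theory Num.Theory.
Import numFieldNormedType.Exports.
Local Open Scope classical_set_scope.
Local Open Scope ring_scope.
Set Implicit Arguments. Unset Strict Implicit. Unset Printing Implicit Defensive.

(** The proof follows a Lyapunov function along the trajectory.  Put
    [V(theta) = sum_k (k |b_k|^2 + |w_k|^2) - 2 L <xi, b_L>].  Differentiating the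
    ReLU network (forward mode) in the direction [v = grad V / 2] rescales the
    k-th layer by k, by positive homogeneity of the ReLU, and produces
    [L (N(x) - xi)] at the output.  Hence [<grad V, G> = 4 L * loss] for the
    generalized gradient [G] of the empirical loss, while
    [|G|^2 <= 4 B * loss] with [B] polynomial in [|theta|].  The step size
    condition makes [gamma B <= 1/2], so each step decreases [V] by at least
    [2 L gamma * loss]: the trajectory is bounded and
    [sum_n gamma_n loss_n(Theta_n)] is bounded uniformly in the sample.  Since
    [Theta_n] is independent of the n-th batch, taking expectations gives
    [sum_n gamma_n E[pop_loss(Theta_n)] < oo]; as [sum_n gamma_n = oo] and the
    population loss moves by at most [C gamma_n] per step, it tends to 0, in mean
    and almost surely. *)

(** The direction [v] comes from a symmetry: replacing [w_k] by [s w_k] and [b_k] by [s^k b_k], for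
    [s > 0], multiplies layer [k] of the ReLU network by [s^k]. This is Euler's identity layer by
    layer and explains the weight [k] on the biases; the term in [xi] only shifts the output bias.
    The obstacle is that [G] is not the gradient of a differentiable function, so no descent
    inequality for the loss itself is at hand. [V] is a quadratic polynomial in [theta], hence only
    the pairing of [G] with [v] and the norm of [G] matter, and both are computed from tangents. As
    [V] does not involve the data, the descent holds on every path and for every batch. [G] is known
    everywhere, kinks included: the thresholds [r^(-1/k)] shrink more slowly with growing depth, so
    each dominates the error inherited from the layers below it. The step size condition sees only
    the initial value, so the bound on the trajectory and the descent of [V] must be proved in a
    single induction, with a radius fixed at time 0. *)

Section SquaredNorm.
Variable R : realType.

Definition nsq n (v : 'cV[R]_n) : R := \sum_i v i ord0 ^+ 2.
Definition dot n (u v : 'cV[R]_n) : R := \sum_i u i ord0 * v i ord0.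
Definition frob m n (W : 'M[R]_(m, n)) : R := \sum_i \sum_j W i j ^+ 2.

Lemma nsq_ge0 n (v : 'cV[R]_n) : 0 <= nsq v.
Proof. by apply: sumr_ge0 => i _; apply: sqr_ge0. Qed.

Lemma frob_ge0 m n (W : 'M[R]_(m, n)) : 0 <= frob W.
Proof. by apply: sumr_ge0 => i _; apply: sumr_ge0 => j _; apply: sqr_ge0. Qed.

Lemma enorm_sqr n (v : 'cV[R]_n) : enorm v ^+ 2 = nsq v.
Proof. by rewrite /enorm sqr_sqrtr // nsq_ge0. Qed.

Lemma enorm_ge0 n (v : 'cV[R]_n) : 0 <= enorm v.
Proof. exact: sqrtr_ge0. Qed.

Lemma dotvv n (v : 'cV[R]_n) : dot v v = nsq v.
Proof. by apply: eq_bigr => i _; rewrite expr2. Qed.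

Lemma nsqD n (u v : 'cV[R]_n) : nsq (u + v) <= 2 * nsq u + 2 * nsq v.
Proof.
rewrite /nsq !mulr_sumr -big_split /=; apply: ler_sum => i _; rewrite !mxE.
by have := sqr_ge0 (u i ord0 - v i ord0); nra.
Qed.

Lemma nsqZ n (c : R) (v : 'cV[R]_n) : nsq (c *: v) = c ^+ 2 * nsq v.
Proof. by rewrite /nsq mulr_sumr; apply: eq_bigr => i _; rewrite !mxE exprMn. Qed.

Lemma dotZr n (c : R) (u v : 'cV[R]_n) : dot u (c *: v) = c * dot u v.
Proof. by rewrite /dot mulr_sumr; apply: eq_bigr => i _; rewrite !mxE mulrCA. Qed.

Lemma coord_le_nsq n (v : 'cV[R]_n) i : v i ord0 ^+ 2 <= nsq v.
Proof.
by rewrite /nsq (bigD1 i) //= lerDl; apply: sumr_ge0 => j _; apply: sqr_ge0.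
Qed.

Lemma young_dot n (e : R) (u v : 'cV[R]_n) : 0 < e ->
  2 * dot u v <= e * nsq u + e^-1 * nsq v.
Proof.
move=> e0; rewrite /dot /nsq !mulr_sumr -big_split /=; apply: ler_sum => i _.
move: (u i ord0) (v i ord0) => x y.
have := mulr_ge0 (ltW e0) (sqr_ge0 (x - e^-1 * y)).
have -> : e * (x - e^-1 * y) ^+ 2 = e * x ^+ 2 + e^-1 * y ^+ 2 - 2 * (x * y).
  by field; rewrite gt_eqF.
by rewrite subr_ge0.
Qed.

Lemma sum_cauchy_schwarz n (f g : 'I_n -> R) :
  (\sum_i f i * g i) ^+ 2 <= (\sum_i f i ^+ 2) * (\sum_i g i ^+ 2).
Proof.
set a := \sum_i f i ^+ 2; set s := \sum_i f i * g i; set b := \sum_i g i ^+ 2.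
have a0 : 0 <= a by apply: sumr_ge0 => i _; apply: sqr_ge0.
have E t : 0 <= t ^+ 2 * a - 2 * t * s + b.
  have -> : t ^+ 2 * a - 2 * t * s + b = \sum_i (t * f i - g i) ^+ 2.
    rewrite /a /s /b !mulr_sumr -sumrB -big_split /=.
    by apply: eq_bigr => i _; ring.
  by apply: sumr_ge0 => i _; apply: sqr_ge0.
have [a00|an0] := eqVneq a 0.
  have fz i : f i = 0.
    apply/eqP; rewrite -sqrf_eq0; move/eqP: a00.
    by rewrite psumr_eq0 => [/allP/(_ i)/(_ (mem_index_enum _))//|j _]; exact: sqr_ge0.
  by rewrite /s big1 ?expr0n ?a00 ?mul0r // => i _; rewrite fz mul0r.
have ap : 0 < a by rewrite lt_def an0.
have := mulr_ge0 a0 (E (s / a)).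
have -> : a * ((s / a) ^+ 2 * a - 2 * (s / a) * s + b) = a * b - s ^+ 2 by field.
by rewrite subr_ge0.
Qed.

Lemma nsq_mulmx m n (W : 'M[R]_(m, n)) (p : 'cV[R]_n) :
  nsq (W *m p) <= frob W * nsq p.
Proof.
rewrite /nsq /frob mulr_suml; apply: ler_sum => i _; rewrite !mxE.
exact: sum_cauchy_schwarz.
Qed.

(** Row by row this is Cauchy-Schwarz for the augmented row [(b_i, W_i)] against [(1, p)]. *)
Lemma nsq_affine m n (b : 'cV[R]_m) (W : 'M[R]_(m, n)) (p : 'cV[R]_n) :
  nsq (b + W *m p) <= (nsq b + frob W) * (1 + nsq p).
Proof.
rewrite /nsq /frob -big_split /= mulr_suml; apply: ler_sum => i _; rewrite !mxE.
have := sum_cauchy_schwarz (W i) (fun j => p j ord0).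
set s := \sum_j _; set w := \sum_j _; set q := \sum_j _ => cs.
suff : 2 * b i ord0 * s <= b i ord0 ^+ 2 * q + w by nra.
rewrite /s /w /q !mulr_sumr -big_split /=; apply: ler_sum => j _.
by have := sqr_ge0 (b i ord0 * p j ord0 - W i j); nra.
Qed.

End SquaredNorm.

(** * Layout of the parameter vector *)

Section ParameterLayout.
Variables (R : realType) (l : nat -> nat) (dd : nat).
Implicit Types (th thp v u : 'cV[R]_dd) (k : nat).

Lemma thc_ord n (w : 'cV[R]_n) (p : 'I_n) : thc w p = w p ord0.
Proof. by rewrite /thc valK. Qed.

Lemma thc_lin n (a : R) (u v : 'cV[R]_n) p : thc (a *: u + v) p = a * thc u p + thc v p.
Proof. by rewrite /thc; case: insubP => [q _ _|_]; rewrite ?mxE // mulr0 addr0. Qed.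

Lemma bias_lin k a u v : bias l k (a *: u + v) = a *: bias l k u + bias l k v.
Proof. by apply/colP => i; rewrite !mxE thc_lin. Qed.

Lemma weight_lin k a u v : weight l k (a *: u + v) = a *: weight l k u + weight l k v.
Proof. by apply/matrixP => i j; rewrite !mxE thc_lin. Qed.

Lemma off_rec k : (0 < k)%N -> off l k.+1 = (off l k + l k * l k.-1 + l k)%N.
Proof. by move=> k0; rewrite /off big_nat_recr //= mulnDr muln1 addnA. Qed.

Lemma leq_off j k : (j <= k)%N -> (off l j <= off l k)%N.
Proof.
move=> jk; rewrite /off; case: (posnP j) => [->|j0]; first by rewrite big_geq.
by rewrite (@big_cat_nat _ _ _ j 1 k) //= leq_addr.
Qed.

Lemma nsq_thc v : nsq v = \sum_(0 <= p < dd) thc v p ^+ 2.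
Proof. by rewrite big_mkord; apply: eq_bigr => p _; rewrite thc_ord. Qed.

(** Layer [k] fills a contiguous block of indices, the weights in row-major order and then the
    biases; its norm is therefore a partial sum of [nsq v]. *)
Lemma layer_nsqE k v : (0 < k)%N ->
  nsq (bias l k v) + frob (weight l k v) =
  \sum_(off l k <= p < off l k.+1) thc v p ^+ 2.
Proof.
move=> k0; rewrite off_rec // addrC.
rewrite (@big_cat_nat _ _ _ (off l k + l k * l k.-1)) ?leq_addr //=; congr (_ + _).
  rewrite -{1}[off l k]add0n big_addn addKn.
  rewrite (big_nat_mul _ (l k)) /frob big_mkord; apply: eq_bigr => i _.
  rewrite -{1}[(i * l k.-1)%N]add0n mulSn big_addn addnK big_mkord.
  by apply: eq_bigr => j _; rewrite mxE; congr (thc _ _ ^+ 2); lia.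
rewrite -{1}[(off l k + l k * l k.-1)%N]add0n big_addn addKn big_mkord.
by apply: eq_bigr => i _; rewrite mxE; congr (thc _ _ ^+ 2); lia.
Qed.

Lemma layer_nsq_le k v : (0 < k)%N -> (off l k.+1 <= dd)%N ->
  nsq (bias l k v) + frob (weight l k v) <= nsq v.
Proof.
move=> k0 kdd; rewrite layer_nsqE // nsq_thc.
have offS : (off l k <= off l k.+1)%N by rewrite leq_off.
rewrite (@big_cat_nat _ _ _ (off l k) 0 dd) ?(leq_trans offS kdd) //=.
rewrite [X in _ + X](@big_cat_nat _ _ _ (off l k.+1)) //=.
have sq_sum m n : 0 <= \sum_(m <= p < n) thc v p ^+ 2.
  by apply: sumr_ge0 => i _; apply: sqr_ge0.
by have := sq_sum 0%N (off l k); have := sq_sum (off l k.+1) dd; lra.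
Qed.

End ParameterLayout.

(** * Tangents of the network and polynomial bounds in the parameters *)

Section Tangent.
Variables (R : realType) (l : nat -> nat) (dd : nat) (Rr : \bar R -> R -> R).
Implicit Types (th thp v u : 'cV[R]_dd) (k : nat) (x : 'cV[R]_(l 0%N)).

Definition dact (r : \bar R) (y : R) : R :=
  if r is EFin _ then derive1 (Rr r) y else (0 < y)%R%:R.

(** The data enter the first layer without activation; absorbing that case here makes the recursion
    [netS] uniform in [k]. *)
Definition inp r th k x : 'cV[R]_(l k) :=
  if k == 0%N then net l Rr r th k x else act Rr (eroot r k) (net l Rr r th k x).

(* Forward-mode derivative of the network in the direction v of parameter
   space; at r = +oo the derivative of the ReLU is read as the indicator of
   (0, +oo), which is the limit of the derivatives of the approximations. *)
Fixpoint tnet r th v k x : 'cV[R]_(l k) :=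
  match k with
  | 0 => 0
  | k'.+1 => (bias l k'.+1 v + weight l k'.+1 v *m inp r th k' x) +
      weight l k'.+1 th *m
        (\col_i (dact (eroot r k') (net l Rr r th k' x i ord0)
                 * tnet r th v k' x i ord0))
  end.

Lemma netS r th k x :
  net l Rr r th k.+1 x = bias l k.+1 th + weight l k.+1 th *m inp r th k x.
Proof. by []. Qed.

Lemma tnet_lin r th a u v k x :
  tnet r th (a *: u + v) k x = a *: tnet r th u k x + tnet r th v k x.
Proof.
elim: k => [|k IH] /=; first by rewrite scaler0 addr0.
rewrite bias_lin weight_lin IH mulmxDl -scalemxAl.
set cu := \col_i (_ * tnet r th u k x i ord0).
set cv := \col_i (_ * tnet r th v k x i ord0).
rewrite [X in _ + weight _ _ _ *m X = _](_ : _ = a *: cu + cv); last first.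
  by apply/colP => i; rewrite !mxE; ring.
set A := _ *m inp _ _ _ _; set B := _ *m inp _ _ _ _.
rewrite mulmxDr -scalemxAr !scalerDr.
by apply/colP => i; rewrite !mxE; ring.
Qed.

Lemma tnet0 r th k x : tnet r th 0 k x = 0.
Proof.
by have := tnet_lin r th (-1) 0 0 k x; rewrite scaler0 addr0 scaleN1r addNr.
Qed.

Lemma tnet_sum r th v k x :
  tnet r th v k x = \sum_p v p ord0 *: tnet r th (delta_mx p ord0) k x.
Proof.
have E : v = \sum_p v p ord0 *: delta_mx p ord0.
  by rewrite {1}[v]matrix_sum_delta; apply: eq_bigr => i _; rewrite big_ord1 ord1.
rewrite {1}E; elim/big_rec2: _ => [|p y z _ <-]; first exact: tnet0.
by rewrite tnet_lin.
Qed.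

Hypothesis HRinf : forall y, Rr +oo%E y = Num.max y 0.

Lemma inp_ooE th k x i : inp +oo%E th k x i ord0 =
  if k == 0%N then net l Rr +oo%E th k x i ord0
  else Num.max (net l Rr +oo%E th k x i ord0) 0.
Proof. by rewrite /inp; case: (k == _) => //; rewrite mxE HRinf. Qed.

Lemma nsq_inp_oo th k x : nsq (inp +oo%E th k x) <= nsq (net l Rr +oo%E th k x).
Proof.
apply: ler_sum => i _; rewrite inp_ooE; case: (k == _) => //.
by move: (net _ _ _ _ _ _ _ _) => y; case: (leP y 0) => ?; rewrite ?expr0n ?sqr_ge0.
Qed.

Variable L : nat.
Hypothesis HL : (0 < L)%N.
Hypothesis Hdd : dd = off l L.+1.

Lemma layer_nsq_leL k v : (k < L)%N ->
  nsq (bias l k.+1 v) + frob (weight l k.+1 v) <= nsq v.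
Proof. by move=> kL; apply: layer_nsq_le => //; rewrite Hdd leq_off. Qed.

(** Carrying the 1 along makes the recursion multiplicative: [1 + |th|^2 (1 + n) <= (1 + |th|^2) (1
    + n)]. *)
Lemma nsq_net_le th x (rho : R) : nsq th + 1 <= rho ->
  forall k, (k <= L)%N -> 1 + nsq (net l Rr +oo%E th k x) <= rho ^+ k * (1 + nsq x).
Proof.
move=> hrho; elim=> [|k IH] kL; first by rewrite expr0 mul1r.
rewrite netS.
have A := nsq_affine (bias l k.+1 th) (weight l k.+1 th) (inp +oo%E th k x).
have B := layer_nsq_leL th kL.
have C := nsq_inp_oo th k x.
have D := nsq_ge0 (inp +oo%E th k x).
have := IH (ltnW kL); rewrite exprS -mulrA.
have th0 := nsq_ge0 th.
set n1 := nsq (net _ _ _ _ _ _) in C *; set K := rho ^+ k * _ => E.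
apply: le_trans (_ : rho * (1 + n1) <= _); last by rewrite ler_wpM2l //; lra.
set n2 := nsq (inp _ _ _ _) in A C D.
have : (nsq (bias l k.+1 th) + frob (weight l k.+1 th)) * (1 + n2) <= nsq th * (1 + n1).
  by apply: ler_pM; rewrite ?addr_ge0 ?nsq_ge0 ?frob_ge0 //; lra.
by nra.
Qed.

(* Covers both the tangents and the differences of two networks, which obey
   the same affine recursion. *)
Lemma nsq_variation_le th thp v x (rho : R) (q s : forall k, 'cV[R]_(l k)) :
  nsq th + 1 <= rho -> nsq thp + 1 <= rho ->
  q 0%N = 0 -> (forall k, nsq (s k) <= nsq (q k)) ->
  (forall k, (k < L)%N -> q k.+1 =
     (bias l k.+1 v + weight l k.+1 v *m inp +oo%E th k x)
       + weight l k.+1 thp *m s k) ->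
  forall k, (k < L)%N ->
    nsq (q k.+1) <= 4 ^+ k * rho ^+ k * (1 + nsq x) * nsq v.
Proof.
move=> h1 h2 q0 sq qS.
(* The first layer has no propagated term and is spared the factor 2 of [nsqD]. So the induction
   starts at [4^0], and it closes because [2 + 2 * 4^k <= 4^(k+1)]. *)
have step k : (k < L)%N -> nsq (q k.+1) <=
    (1 + (k != 0%N)%:R) * nsq v * (rho ^+ k * (1 + nsq x))
      + 2 * rho * nsq (q k).
  move=> kL; rewrite qS //.
  have A := nsq_affine (bias l k.+1 v) (weight l k.+1 v) (inp +oo%E th k x).
  have B := layer_nsq_leL v kL.
  have C := nsq_inp_oo th k x.
  have D := nsq_ge0 (inp +oo%E th k x).
  have E := nsq_net_le x h1 (ltnW kL).
  have F : nsq (bias l k.+1 v + weight l k.+1 v *m inp +oo%E th k x) <=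
           nsq v * (rho ^+ k * (1 + nsq x)).
    apply: le_trans A _; apply: ler_pM; rewrite ?addr_ge0 ?nsq_ge0 ?frob_ge0 //; lra.
  have fr : frob (weight l k.+1 thp) <= rho.
    have := layer_nsq_leL thp kL; have := nsq_ge0 (bias l k.+1 thp); lra.
  have H : nsq (weight l k.+1 thp *m s k) <= rho * nsq (q k).
    apply: le_trans (nsq_mulmx _ _) _.
    by apply: ler_pM; rewrite ?frob_ge0 ?nsq_ge0 ?sq.
  case: k kL {A B C D E fr qS} F H => [|k] kL F H /=.
    have s0 : s 0%N = 0.
      apply/colP => i; rewrite mxE; apply/eqP; rewrite -sqrf_eq0; apply/eqP/le_anti.
      rewrite sqr_ge0 andbT (le_trans (coord_le_nsq _ _)) // (le_trans (sq _)) // q0.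
      by rewrite /nsq big1 // => j _; rewrite mxE expr0n.
    rewrite s0 mulmx0 addr0 q0 /nsq [X in 2 * rho * X]big1 => [|j _]; last by rewrite mxE expr0n.
    by move: F; rewrite /nsq; lra.
  apply: le_trans (nsqD _ _) _; lra.
have rho0 : 0 <= rho by have := nsq_ge0 th; lra.
have K0 : 0 <= 1 + nsq x by have := nsq_ge0 x; lra.
have v0 := nsq_ge0 v.
elim=> [|k IH] kL.
  have := step 0%N kL; rewrite q0 /= /nsq [X in 2 * rho * X]big1; last by move=> j _; rewrite mxE expr0n.
  by rewrite !expr0; rewrite -/(nsq _) -/(nsq v) -/(nsq x); lra.
have := step k.+1 kL => /=; rewrite !exprS.
have := ler_wpM2l rho0 (IH (ltnW kL)).
set N := nsq (q k.+1).
have P4 : 1 <= 4 ^+ k :> R by rewrite exprn_ege1 //; lra.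
set f := 4 ^+ k in P4 *; set g := rho ^+ k * (1 + nsq x).
have g0 : 0 <= rho * g * nsq v by rewrite !mulr_ge0 ?exprn_ge0.
rewrite (_ : rho * (f * rho ^+ k * _ * _) = f * (rho * g * nsq v)); last by rewrite /g; ring.
rewrite (_ : 4 * f * (rho * _) * _ * _ = 4 * f * (rho * g * nsq v)); last by rewrite /g; ring.
rewrite (_ : (1 + 1) * _ * _ = 2 * (rho * g * nsq v)); last by rewrite /g; ring.
set t := rho * g * nsq v in g0 *; nra.
Qed.

Lemma nsq_tnet_le th v x (rho : R) : nsq th + 1 <= rho -> forall k, (k < L)%N ->
  nsq (tnet +oo%E th v k.+1 x) <= 4 ^+ k * rho ^+ k * (1 + nsq x) * nsq v.
Proof.
move=> h; apply: (nsq_variation_le (q := fun k => tnet +oo%E th v k x)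
  (s := fun k => \col_i (dact (eroot +oo%E k) (net l Rr +oo%E th k x i ord0)
                 * tnet +oo%E th v k x i ord0)) h h) => // k.
apply: ler_sum => i _; rewrite mxE exprMn /=; case: (0 < _)%R => /=.
  by rewrite expr1n mul1r.
by rewrite expr0n mul0r sqr_ge0.
Qed.

(** Writing [w' p' - w p = (w' - w) p + w' (p' - p)] gives the required recursion, and the ReLU is
    1-Lipschitz in each coordinate. *)
Lemma nsq_net_diff_le th thp x (rho : R) : nsq th + 1 <= rho -> nsq thp + 1 <= rho ->
  forall k, (k < L)%N ->
  nsq (net l Rr +oo%E thp k.+1 x - net l Rr +oo%E th k.+1 x) <=
    4 ^+ k * rho ^+ k * (1 + nsq x) * nsq (thp - th).
Proof.
move=> h1 h2; apply: (nsq_variation_le (th := th) (thp := thp)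
  (q := fun k => net l Rr +oo%E thp k x - net l Rr +oo%E th k x)
  (s := fun k => inp +oo%E thp k x - inp +oo%E th k x)) => // [|k|k kL].
- by rewrite /= subrr.
- apply: ler_sum => i _; rewrite 4!mxE !inp_ooE; case: (k == _) => //.
  move: (net _ _ _ _ _ _ _ _) (net _ _ _ _ _ _ _ _) => y z.
  by case: (leP y 0); case: (leP z 0) => ? ?; have := sqr_ge0 (z - y); nra.
have -> : thp - th = (-1) *: th + thp by rewrite scaleN1r addrC.
rewrite !netS bias_lin weight_lin !scaleN1r mulmxDl mulNmx mulmxBr.
set A := _ *m inp _ _ _ _; set B := _ *m inp _ _ _ _; set C := _ *m inp _ _ _ _.
by apply/colP => i; rewrite !mxE; ring.
Qed.

End Tangent.

(** * The Lyapunov function and Euler's identity for the ReLU network *)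

Section Lyapunov.
Variables (R : realType) (l : nat -> nat) (dd : nat).
Implicit Types (th v G : 'cV[R]_dd) (k p : nat).

Lemma thc_col (f : nat -> R) p : (p < dd)%N -> thc (\col_(q < dd) f q) p = f p.
Proof. by move=> pd; rewrite -[p]/(val (Ordinal pd)) thc_ord mxE. Qed.

(* Weight of coordinate p in the Lyapunov function: 1 on weights, and k on the
   biases of layer k. *)
Fixpoint kap k p : R :=
  if k is k'.+1 then
    if (p < off l k)%N then kap k' p
    else if (p < off l k + l k * l k.-1)%N then 1 else k%:R
  else 1.

Lemma kap_ge1 k p : 1 <= kap k p.
Proof.
elim: k => //= k IH; case: ifP => // _; case: ifP => // _.
by rewrite ler1n.
Qed.

Lemma kap_le k p : (0 < k)%N -> kap k p <= k%:R.
Proof.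
elim: k => //= k IH _; case: ifP => _; last by case: ifP => // _; rewrite ler1n.
case: k IH => // k IH; apply: le_trans (IH _) _ => //.
by rewrite ler_nat.
Qed.

Lemma kap_weight k j p : (0 < j <= k)%N ->
  (off l j <= p < off l j + l j * l j.-1)%N -> kap k p = 1.
Proof.
elim: k => [|k IH] //= /andP[j0 jk] /andP[p1 p2].
case: ltnP => pk; last first.
  move: jk; rewrite leq_eqVlt => /orP[/eqP jk|jk]; first by move: p2; rewrite jk /= => ->.
  have := @leq_off l j.+1 k.+1 jk; rewrite off_rec //; lia.
apply: IH; last by rewrite p1 p2.
rewrite j0; move: jk; rewrite leq_eqVlt => /orP[/eqP jk|//].
by subst j; lia.
Qed.

Lemma kap_bias k j p : (0 < j <= k)%N ->
  (off l j + l j * l j.-1 <= p < off l j.+1)%N -> kap k p = j%:R.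
Proof.
elim: k => [|k IH] //= /andP[j0 jk] /andP[p1 p2]; first by lia.
case: ltnP => pk; last first.
  move: jk; rewrite leq_eqVlt => /orP[/eqP jk|jk].
    by move: p1; rewrite jk /= ltnNge => ->.
  have := @leq_off l j.+1 k.+1 jk; lia.
apply: IH; last by rewrite p1 p2.
rewrite j0; move: jk; rewrite leq_eqVlt => /orP[/eqP jk|//].
by subst j; lia.
Qed.

Variables (L : nat) (xi : 'cV[R]_(l L)).

Let cut := (off l L + l L * l L.-1)%N.

(** The target padded to parameter space at the position of the output biases, so that [<xi, b_L>]
    is the inner product of [zeta] and [theta]. *)
Definition zeta p : R := if (cut <= p)%N then thc xi (p - cut) else 0.

(* Half the gradient of the Lyapunov function. *)
Definition lyap_dir th : 'cV[R]_dd :=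
  \col_(p < dd) (kap L p * thc th p - L%:R * zeta p).

Lemma thc_lyap_dir th p : (p < dd)%N ->
  thc (lyap_dir th) p = kap L p * thc th p - L%:R * zeta p.
Proof. exact: (thc_col (fun p => kap L p * thc th p - L%:R * zeta p)). Qed.

Definition lyap th : R :=
  \sum_(p < dd) (kap L p * th p ord0 ^+ 2 - 2 * L%:R * zeta p * th p ord0).

Hypothesis HL : (0 < L)%N.
Hypothesis Hdd : dd = off l L.+1.

Let L1 : 1 <= L%:R :> R. Proof. by rewrite ler1n. Qed.

Lemma off_le_dd k : (k <= L)%N -> (off l k.+1 <= dd)%N.
Proof. by move=> kL; rewrite Hdd leq_off. Qed.

(** The linear term of [lyap] lives only where the quadratic coefficient is [L]; completing the
    square there costs at most [2 L |xi|^2], as [lyap_lower] needs. *)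
Lemma zeta_kap p : zeta p = 0 \/ kap L p = L%:R.
Proof.
rewrite /zeta /cut; case: leqP => c; last by left.
right; case: L HL c => //= k _ c.
by case: ltnP => [|_]; [lia|rewrite ltnNge c].
Qed.

Lemma zeta_sum : \sum_(p < dd) zeta p ^+ 2 = nsq xi.
Proof.
have E : dd = (cut + l L)%N by rewrite Hdd off_rec // /cut.
rewrite -(big_mkord xpredT (fun p => zeta p ^+ 2)) E.
rewrite (@big_cat_nat _ _ _ cut) ?leq_addr //= big_nat big1 => [|p]; last first.
  by case/andP => _ pc; rewrite /zeta leqNgt pc expr0n.
rewrite add0r -{1}[cut]add0n big_addn addKn big_mkord; apply: eq_bigr => i _.
by rewrite /zeta leq_addl addnK thc_ord.
Qed.

Lemma bias_lyap_dir th k : (0 < k < L)%N ->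
  bias l k (lyap_dir th) = k%:R *: bias l k th.
Proof.
move=> /andP[k0 kL]; apply/colP => i; rewrite !mxE.
have := ltn_ord i; have := @off_le_dd k (ltnW kL).
have := @leq_off l k.+1 L kL; rewrite off_rec // => A B C.
rewrite thc_lyap_dir; last by lia.
rewrite (@kap_bias L k); last 2 first.
- by rewrite k0 ltnW.
- by rewrite off_rec //; lia.
rewrite /zeta /cut leqNgt (_ : (_ < _)%N) /= ?mulr0 ?subr0 //; lia.
Qed.

Lemma bias_lyap_dirL th :
  bias l L (lyap_dir th) = L%:R *: (bias l L th - xi).
Proof.
apply/colP => i; rewrite !mxE.
have := ltn_ord i; have := @off_le_dd L (leqnn _).
rewrite off_rec // => B C.
rewrite thc_lyap_dir; last by lia.
rewrite (@kap_bias L L); last 2 first.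
- by rewrite HL leqnn.
- by rewrite off_rec //; lia.
rewrite /zeta /cut (_ : (_ <= _)%N = true); last by lia.
rewrite (_ : (_ - _)%N = i); last by lia.
by rewrite thc_ord mulrBr.
Qed.

Lemma weight_lyap_dir th k : (0 < k <= L)%N ->
  weight l k (lyap_dir th) = weight l k th.
Proof.
move=> /andP[k0 kL]; apply/matrixP => i j; rewrite !mxE.
have := @off_le_dd k kL.
have := @leq_off l k L kL; rewrite off_rec // => A B.
have C : (i * l k.-1 + j < l k * l k.-1)%N.
  by have := ltn_ord i; have := ltn_ord j; nia.
rewrite thc_lyap_dir; last by lia.
rewrite (@kap_weight L k); last 2 first.
- by rewrite k0.
- by lia.
rewrite /zeta /cut leqNgt (_ : (_ < _)%N) /= ?mulr0 ?subr0 ?mul1r //.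
move: kL; rewrite leq_eqVlt => /orP[/eqP kL|kL]; first by subst k; lia.
by have := @leq_off l k.+1 L kL; rewrite off_rec //; lia.
Qed.

Lemma lyap_lower th : 2^-1 * nsq th - 2 * L%:R * nsq xi <= lyap th.
Proof.
rewrite -zeta_sum /nsq !mulr_sumr -sumrB; apply: ler_sum => p _.
have := kap_ge1 L p; move: (th p ord0) => t.
have [->|->] := zeta_kap p => k1; first by have := sqr_ge0 t; nra.
by move: (zeta p) L1 => z; have := sqr_ge0 (t - 2 * z); have := sqr_ge0 t; nra.
Qed.

Lemma lyap_upper th : lyap th <= 2 * L%:R * nsq th + L%:R * nsq xi.
Proof.
rewrite -zeta_sum /nsq !mulr_sumr -big_split /=; apply: ler_sum => p _.
have := kap_le p HL; move: (th p ord0) (zeta p) => t z k1.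
by have := sqr_ge0 (t + z); have := sqr_ge0 t; move: L1 => ?; nra.
Qed.

(** [lyap] is quadratic with diagonal Hessian [2 kap], so its second-order expansion is exact, and
    [kap <= L] bounds the remainder. *)
Lemma lyap_step th G (g : R) :
  lyap (th - g *: G) <=
    lyap th - 2 * g * dot (lyap_dir th) G + g ^+ 2 * L%:R * nsq G.
Proof.
rewrite /lyap /dot /nsq !mulr_sumr -sumrB -big_split /=; apply: ler_sum => p _.
rewrite !mxE thc_ord; have := kap_le p HL.
move: (th p ord0) (zeta p) (kap L p) (G p ord0) => t z k s kL.
have := ler_wpM2r (sqr_ge0 (g * s)) kL; rewrite exprMn.
by nra.
Qed.

Variable Rr : \bar R -> R -> R.
Hypothesis HRinf : forall y, Rr +oo%E y = Num.max y 0.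
Implicit Types x : 'cV[R]_(l 0%N).

Local Notation netoo := (net l Rr +oo%E).
Local Notation tnoo := (tnet Rr +oo%E).

(* The ReLU is positively homogeneous, so the indicator of its derivative
   multiplied by the input gives the ReLU back. *)
Lemma inp_homog th k x (c : R) : (k == 0%N) = false ->
  (\col_i (dact Rr (eroot +oo%E k) (netoo th k x i ord0)
       * (c *: netoo th k x) i ord0)) = c *: inp Rr +oo%E th k x.
Proof.
move=> k0; apply/colP => i; rewrite 3!mxE inp_ooE // k0 /=.
move: (netoo _ _ _ _ _) => y; case: (leP y 0) => h /=.
  by rewrite mul0r mulr0.
by rewrite mul1r.
Qed.

(** In the recursion the factor [k + 1] of the product term splits into 1, from varying the weights,
    and [k], passed on from the layer below; the bias has the factor [k + 1] by the choice of
    [kap]. *)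
Lemma tnet_lyap_dir_lt th x k : (k < L)%N ->
  tnoo th (lyap_dir th) k x = k%:R *: (if k == 0%N then 0 else netoo th k x).
Proof.
elim: k => [|k IH] kL; first by rewrite scaler0.
rewrite /= IH ?(ltnW kL) // bias_lyap_dir // weight_lyap_dir ?(ltnW kL) //.
case k0: (k == 0%N).
  move/eqP: k0 => k0; subst k; rewrite scale1r.
  rewrite [X in _ + _ *m X](_ : _ = 0) ?mulmx0 ?addr0 ?scale1r //.
  by apply/colP => i; rewrite !mxE !mulr0.
rewrite inp_homog // -scalemxAr /inp k0 /layer_aff.
rewrite (_ : k.+1%:R = 1 + k%:R :> R) ?mulrS // !scalerDl !scale1r /eroot.
by apply/colP => i; rewrite !mxE; ring.
Qed.

End Lyapunov.

(** At the output layer the shift by [- L xi] in the bias turns [L N] into [L (N - xi)], the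
    residual of the loss. *)
Lemma tnet_lyap_dir (R : realType) (l : nat -> nat) (dd L : nat) (xi : 'cV[R]_(l L))
    (Rr : \bar R -> R -> R) (th : 'cV[R]_dd) (x : 'cV[R]_(l 0%N)) :
  (0 < L)%N -> dd = off l L.+1 -> (forall y, Rr +oo%E y = Num.max y 0) ->
  tnet Rr +oo%E th (lyap_dir xi th) L x =
    L%:R *: (net l Rr +oo%E th L x - xi).
Proof.
case: L xi => // L xi _ Hdd HRinf.
rewrite /= tnet_lyap_dir_lt // bias_lyap_dirL // weight_lyap_dir ?leqnn //.
case k0: (L == 0%N).
  move/eqP: k0 => k0; subst L; rewrite scale1r.
  rewrite [X in _ + _ *m X](_ : _ = 0) ?mulmx0 ?addr0 ?scale1r //; last first.
    by apply/colP => i; rewrite !mxE !mulr0.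
  by rewrite addrAC.
rewrite inp_homog // -scalemxAr /inp k0.
rewrite (_ : L.+1%:R = 1 + L%:R :> R) ?mulrS // !scalerDl !scale1r /eroot /layer_aff.
by apply/colP => i; rewrite !mxE; ring.
Qed.

(** * Descent along the generalized gradient *)

Section Descent.
Variables (R : realType) (l : nat -> nat) (dd L : nat) (xi : 'cV[R]_(l L)).
Variable Rr : \bar R -> R -> R.
Hypothesis HL : (0 < L)%N.
Hypothesis Hdd : dd = off l L.+1.
Hypothesis HRinf : forall y, Rr +oo%E y = Num.max y 0.
Implicit Types (th v : 'cV[R]_dd) (x : 'cV[R]_(l 0%N)) (xs : nat -> 'cV[R]_(l 0%N)).

Definition sloss th x : R := nsq (net l Rr +oo%E th L x - xi).
Definition gdir th v x : R :=
  2 * dot (net l Rr +oo%E th L x - xi) (tnet Rr +oo%E th v L x).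
Definition eloss th m xs : R := m%:R^-1 * \sum_(i < m) sloss th (xs i).
(** The closed form of the limit of the smoothed gradients; [grad_emp_loss_cvg] identifies the
    two. *)
Definition ggrad th m xs : 'cV[R]_dd :=
  \col_p (m%:R^-1 * \sum_(i < m) gdir th (delta_mx p ord0) (xs i)).

Lemma sloss_ge0 th x : 0 <= sloss th x. Proof. exact: nsq_ge0. Qed.

Lemma eloss_ge0 th m xs : 0 <= eloss th m xs.
Proof. by rewrite mulr_ge0 ?invr_ge0 // sumr_ge0 // => i _; exact: sloss_ge0. Qed.

(** Although [ggrad] is defined coordinate by coordinate and need not be a gradient, linearity of
    the tangent in its direction allows pairing it with any [v]. *)
Lemma dot_ggrad th v m xs :
  dot v (ggrad th m xs) = m%:R^-1 * \sum_(i < m) gdir th v (xs i).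
Proof.
have E x : gdir th v x = \sum_p v p ord0 * gdir th (delta_mx p ord0) x.
  rewrite {1}/gdir tnet_sum /dot.
  transitivity (2 * \sum_j \sum_p v p ord0 * ((net l Rr +oo%E th L x - xi) j ord0 *
     tnet Rr +oo%E th (delta_mx p ord0) L x j ord0)).
    congr (2 * _); apply: eq_bigr => j _; rewrite summxE mulr_sumr.
    by apply: eq_bigr => p _; rewrite !mxE; ring.
  rewrite exchange_big /= mulr_sumr; apply: eq_bigr => p _.
  by rewrite /gdir /dot -mulr_sumr; ring.
under [in RHS]eq_bigr do rewrite E.
rewrite exchange_big /= mulr_sumr; apply: eq_bigr => p _.
by rewrite mxE -[in RHS]mulr_sumr; ring.
Qed.

Lemma dot_lyap_dir_ggrad th m xs :
  dot (lyap_dir xi th) (ggrad th m xs) = 2 * L%:R * eloss th m xs.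
Proof.
rewrite dot_ggrad /eloss [RHS]mulrCA; congr (_ * _); rewrite mulr_sumr.
by apply: eq_bigr => i _; rewrite /gdir tnet_lyap_dir // dotZr dotvv /sloss; ring.
Qed.

Variables (rho K : R).
Let B := 4 ^+ L.-1 * rho ^+ L.-1 * K.

Lemma nsq_tnetL_le th v x : nsq th + 1 <= rho -> 1 + nsq x <= K ->
  nsq (tnet Rr +oo%E th v L x) <= B * nsq v.
Proof.
rewrite /B => h xK; case: L xi HL Hdd => // L' xi' _ Hdd'.
apply: le_trans (@nsq_tnet_le R l dd Rr HRinf L'.+1 Hdd' th v x rho h _ _) _ => //=.
have r0 : 0 <= rho by have := nsq_ge0 th; lra.
by rewrite ler_wpM2r ?nsq_ge0 // ler_wpM2l // mulr_ge0 ?exprn_ge0.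
Qed.

Lemma nsq_net_diffL_le th thp x : nsq th + 1 <= rho -> nsq thp + 1 <= rho ->
  1 + nsq x <= K ->
  nsq (net l Rr +oo%E thp L x - net l Rr +oo%E th L x) <= B * nsq (thp - th).
Proof.
rewrite /B => h h' xK; case: L xi HL Hdd => // L' xi' _ Hdd'.
apply: le_trans (@nsq_net_diff_le R l dd Rr HRinf L'.+1 Hdd' th thp x rho h h' _ _) _ => //=.
have r0 : 0 <= rho by have := nsq_ge0 th; lra.
by rewrite ler_wpM2r ?nsq_ge0 // ler_wpM2l // mulr_ge0 ?exprn_ge0.
Qed.

Lemma sloss_le th x : nsq th + 1 <= rho -> 1 + nsq x <= K ->
  sloss th x <= 2 * (rho ^+ L * K) + 2 * nsq xi.
Proof.
move=> h xK; apply: le_trans (nsqD _ _) _.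
have -> : nsq (- xi) = nsq xi by rewrite -scaleN1r nsqZ sqrrN expr1n mul1r.
rewrite lerD2r ler_wpM2l //.
have := @nsq_net_le R l dd Rr HRinf L Hdd th x rho h L (leqnn _).
have r0 : 0 <= rho by have := nsq_ge0 th; lra.
have := ler_wpM2l (exprn_ge0 L r0) xK; lra.
Qed.

(** The gradient [g] is tested against itself. Young's inequality with weight [2 B] and the tangent
    bound [B * nsq g] leave half of [nsq g] on the right, which is absorbed; no sum over
    coordinates, hence no factor [dd], appears. *)
Lemma nsq_ggrad_le th m xs : (0 < m)%N -> nsq th + 1 <= rho ->
  (forall i, 1 + nsq (xs i) <= K) ->
  nsq (ggrad th m xs) <= 4 * B * eloss th m xs.
Proof.
move=> m0 h xK; set g := ggrad th m xs.
have r0 : 0 < rho by have := nsq_ge0 th; lra.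
have K0 : 0 < K by have := xK 0%N; have := nsq_ge0 (xs 0%N); lra.
have B0 : 0 < B by rewrite /B !mulr_gt0 ?exprn_gt0.
have mR : m%:R != 0 :> R by rewrite pnatr_eq0 -lt0n.
suff : nsq g <= 2 * B * eloss th m xs + 2^-1 * nsq g by lra.
rewrite -{1}dotvv dot_ggrad -/g.
apply: le_trans (_ : m%:R^-1 * \sum_(i < m) (2 * B * sloss th (xs i) + 2^-1 * nsq g) <= _).
  rewrite ler_wpM2l ?invr_ge0 // ler_sum // => i _; rewrite /gdir.
  have e0 : 0 < 2 * B by lra.
  apply: le_trans (young_dot _ _ e0) _; rewrite lerD2l.
  have := ler_wpM2l (ltW (_ : 0 < (2 * B)^-1)) (nsq_tnetL_le g h (xK i)).
  rewrite invr_gt0 => /(_ e0) /le_trans; apply.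
  by rewrite le_eqVlt; apply/orP; left; apply/eqP; field; rewrite gt_eqF.
rewrite big_split /= -mulr_sumr sumr_const card_ord /eloss -mulr_natl.
by rewrite le_eqVlt; apply/orP; left; apply/eqP; field.
Qed.

Lemma lyap_descent th m xs (g : R) : (0 < m)%N -> nsq th + 1 <= rho ->
  (forall i, 1 + nsq (xs i) <= K) -> 0 <= g -> g * B <= 2^-1 ->
  lyap xi (th - g *: ggrad th m xs) <= lyap xi th - 2 * L%:R * (g * eloss th m xs).
Proof.
move=> m0 h xK g0 gB; apply: le_trans (lyap_step xi HL _ _ _) _.
rewrite dot_lyap_dir_ggrad.
have := nsq_ggrad_le m0 h xK; set N := nsq _; set E := eloss _ _ _ => NB.
have E0 : 0 <= E := eloss_ge0 _ _ _.
have L0 : 1 <= L%:R :> R by rewrite ler1n.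
(* The first-order gain is [4 L g E]; the remainder is at most [4 (g B) L g E], half of that
   gain. *)
have : g ^+ 2 * L%:R * N <= g ^+ 2 * L%:R * (4 * B * E).
  by rewrite ler_wpM2l // mulr_ge0 ?sqr_ge0 //; lra.
have P : 0 <= L%:R * (g * E) by apply: mulr_ge0; [lra | exact: mulr_ge0].
have := ler_wpM2r P gB; set b := B in NB * => H1 H2.
have -> : 2 * L%:R * (g * E) = 2 * (L%:R * (g * E)) by ring.
have -> : 2 * g * (2 * L%:R * E) = 4 * (L%:R * (g * E)) by ring.
have : g ^+ 2 * L%:R * (4 * b * E) = 4 * (g * b * (L%:R * (g * E))) by ring.
by lra.
Qed.

(** Cauchy-Schwarz is applied to [|p|^2 - |q|^2 = <p - q, p + q>]. The final [+ 1] replaces a square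
    root, through [t <= (t + 1)^2] for [t >= 0]. *)
Lemma sloss_variation th thp x (g D : R) : nsq th + 1 <= rho -> nsq thp + 1 <= rho ->
  1 + nsq x <= K -> 0 <= g -> 0 <= D -> nsq (thp - th) <= g ^+ 2 * D ->
  `|sloss thp x - sloss th x| <=
     g * (B * D * (8 * (rho ^+ L * K) + 8 * nsq xi) + 1).
Proof.
move=> h h' xK g0 D0 hD.
set p := net l Rr +oo%E thp L x - xi; set q := net l Rr +oo%E th L x - xi.
set E := 8 * _ + _.
have r0 : 0 <= rho by have := nsq_ge0 th; lra.
have K0 : 0 <= K by have := nsq_ge0 x; lra.
have B0 : 0 <= B by rewrite /B !mulr_ge0 ?exprn_ge0.
have sqB (u w : 'cV[R]_(l L)) : nsq u - nsq w = dot (u - w) (u + w).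
  rewrite /nsq /dot -sumrB; apply: eq_bigr => i _; rewrite !mxE; ring.
rewrite [X in `|X|](sqB p q).
have pq : nsq (p - q) <= g ^+ 2 * (B * D).
  have -> : p - q = net l Rr +oo%E thp L x - net l Rr +oo%E th L x.
    by rewrite /p /q opprB addrA subrK.
  apply: le_trans (nsq_net_diffL_le h h' xK) _.
  by have := ler_wpM2l B0 hD; lra.
have pE : nsq (p + q) <= E.
  apply: le_trans (nsqD _ _) _.
  have := sloss_le h xK; have := sloss_le h' xK.
  by rewrite /sloss -/p -/q /E; lra.
have E0 : 0 <= E by apply: le_trans pE; exact: nsq_ge0.
have BDE0 : 0 <= B * D * E by apply: mulr_ge0 => //; exact: mulr_ge0.
have gE0 : 0 <= g * (B * D * E + 1) by apply: mulr_ge0 => //; lra.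
rewrite -ler_sqr ?nnegrE ?normr_ge0 //.
rewrite real_normK ?num_real //.
have : dot (p - q) (p + q) ^+ 2 <= nsq (p - q) * nsq (p + q).
  exact: (sum_cauchy_schwarz (fun i => (p - q) i ord0) (fun i => (p + q) i ord0)).
move=> /le_trans; apply.
have : nsq (p - q) * nsq (p + q) <= g ^+ 2 * (B * D) * E.
  by apply: ler_pM; rewrite ?nsq_ge0.
move=> /le_trans; apply; rewrite -mulrA exprMn ler_wpM2l ?sqr_ge0 //.
by move: BDE0; set t := B * D * E; nra.
Qed.

End Descent.

(** With [W = (4 L d c u)^2] the hypothesis reads [g W^L <= 1]. Each of the [L - 1] factors
    [28 L c^2 u^2] is at most [W], for which [1 < d] leaves room, and the last factor [d c^2] is at
    most [W / 2]. *)
Lemma step_size_bound (R : realFieldType) (L d : nat) (c u g : R) :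
  (0 < L)%N -> (1 < d)%N -> 1 <= c -> 1 <= u -> 0 <= g ->
  (4 * L%:R * d%:R * c) ^+ (2 * L) * g <= (u ^+ (2 * L))^-1 ->
  g * (4 ^+ L.-1 * (7 * L%:R * c ^+ 2 * u ^+ 2) ^+ L.-1 * (d%:R * c ^+ 2)) <= 2^-1.
Proof.
case: L => // n _ d1 c1 u1 g0; set N := n.+1%:R; rewrite [n.+1.-1]/=.
have N1 : 1 <= N by rewrite ler1n.
have d2 : 2 <= d%:R :> R by rewrite ler_nat.
set t := d%:R in d2 *.
have up : 0 < u by lra.
rewrite -[leRHS]mul1r ler_pdivlMr ?exprn_gt0 // => H.
have {}H : g * ((4 * N * t * c * u) ^+ 2) ^+ n.+1 <= 1.
  apply: le_trans H; rewrite -exprM [X in g * X]exprMn.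
  by rewrite le_eqVlt; apply/orP; left; apply/eqP; ring.
have c2 : 1 <= c ^+ 2 by rewrite expr_ge1 //; lra.
have u2 : 1 <= u ^+ 2 by rewrite expr_ge1 //; lra.
have Q1 : (4 * N * t * c * u) ^+ 2 = 16 * (N * t) ^+ 2 * (c ^+ 2 * u ^+ 2) by ring.
have P1 : 1 <= c ^+ 2 * u ^+ 2 by nra.
have Nt : 2 * N <= N * t by nra.
have Nt2 : t <= N * t by nra.
have Nt3 : 1 <= N * t by nra.
have A : 4 ^+ n * (7 * N * c ^+ 2 * u ^+ 2) ^+ n <= ((4 * N * t * c * u) ^+ 2) ^+ n.
  rewrite -exprMn lerXn2r ?nnegrE ?sqr_ge0 //; first by nra.
  rewrite Q1 (_ : 4 * _ = 28 * N * (c ^+ 2 * u ^+ 2)); last by ring.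
  by rewrite ler_wpM2r //; nra.
have A2 : t * c ^+ 2 <= 2^-1 * (4 * N * t * c * u) ^+ 2.
  rewrite Q1 (_ : 2^-1 * _ = (8 * (N * t) ^+ 2 * c ^+ 2) * u ^+ 2); last by field.
  rewrite -[leLHS]mulr1; apply: ler_pM => //; first by nra.
  by apply: ler_wpM2r; nra.
have E0 : 0 <= 4 ^+ n * (7 * N * c ^+ 2 * u ^+ 2) ^+ n.
  by rewrite mulr_ge0 ?exprn_ge0 //; nra.
have E1 : 0 <= t * c ^+ 2 by nra.
have := ler_pM E0 E1 A A2.
set W := (4 * N * t * c * u) ^+ 2 in H *.
move=> /(ler_wpM2l g0) /le_trans; apply.
have -> : g * (W ^+ n * (2^-1 * W)) = 2^-1 * (g * W ^+ n.+1) by rewrite exprSr; ring.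
by lra.
Qed.

(** * Pathwise bounds on a trajectory *)

Section Trajectory.
Variables (R : realType) (l : nat -> nat) (dd L : nat) (xi : 'cV[R]_(l L)).
Variable Rr : \bar R -> R -> R.
Hypothesis HL : (0 < L)%N.
Hypothesis Hl : forall k, (0 < l k)%N.
Hypothesis Hdd : dd = off l L.+1.
Hypothesis HRinf : forall y, Rr +oo%E y = Num.max y 0.

Variable c : R.
Hypothesis c1 : 1 <= c.
Hypothesis xic : nsq xi <= c ^+ 2.

Let c2 : 1 <= c ^+ 2. Proof. by rewrite expr_ge1 //; move: c1; lra. Qed.

(** The first layer alone has [l 1 * (l 0 + 1)] parameters; this lets [dd] bound the input dimension
    in [nsq_input_le]. *)
Lemma dd_ge : (l 0 + 1 <= dd)%N.
Proof.
rewrite Hdd; apply: leq_trans (@leq_off l 2 L.+1 _) => //.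
by rewrite /off big_nat1 leq_pmull.
Qed.

Lemma dd_gt1 : (1 < dd)%N.
Proof. by apply: leq_trans dd_ge; rewrite addn1 ltnS. Qed.

Lemma nsq_input_le (x : 'cV[R]_(l 0%N)) : (forall i, `|x i ord0| <= c) ->
  1 + nsq x <= dd%:R * c ^+ 2.
Proof.
move=> xc; apply: le_trans (_ : (l 0 + 1)%:R * c ^+ 2 <= _); last first.
  by rewrite ler_wpM2r ?sqr_ge0 // ler_nat dd_ge.
rewrite natrD mulrDl mul1r addrC; apply: lerD; last exact: c2.
apply: le_trans (_ : \sum_(i < l 0) c ^+ 2 <= _).
  apply: ler_sum => i _; rewrite -real_normK ?num_real // lerXn2r ?nnegrE //.
  by move: c1; lra.
by rewrite sumr_const card_ord mulr_natl.
Qed.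

Variables (theta : nat -> 'cV[R]_dd) (gamma : nat -> R) (m : nat -> nat).
Variable xs : nat -> nat -> 'cV[R]_(l 0%N).
Hypothesis xsc : forall n i j, `|xs n i j ord0| <= c.
Hypothesis m0 : forall n, (0 < m n)%N.
Hypothesis g0 : forall n, 0 <= gamma n.
Hypothesis theta_rec :
  forall n, theta n.+1 = theta n - gamma n *: ggrad xi Rr (theta n) (m n) (xs n).
Let u := enorm (theta 0%N) + 1.
Hypothesis step : forall n,
  (4 * L%:R * dd%:R * c) ^+ (2 * L) * gamma n <= (u ^+ (2 * L))^-1.

Let rho := 7 * L%:R * c ^+ 2 * u ^+ 2.
Let L1 : 1 <= L%:R :> R. Proof. by rewrite ler1n. Qed.

(** Origin of the 7 in [rho]: the two bounds on [lyap] give [nsq th <= 4 L (u - 1)^2 + 6 L c^2], and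
    the additional 1 is at most [L c^2]. *)
Lemma nsq_le_of_lyap (th : 'cV[R]_dd) :
  lyap xi th <= lyap xi (theta 0%N) -> nsq th + 1 <= rho.
Proof.
move=> h; have lo := lyap_lower xi HL Hdd th.
have up := lyap_upper xi HL Hdd (theta 0%N).
have e0 := enorm_ge0 (theta 0%N).
have E : nsq (theta 0%N) = (u - 1) ^+ 2 by rewrite /u addrK enorm_sqr.
have u1 : 1 <= u by rewrite /u; lra.
rewrite E in up.
have : nsq th <= 4 * L%:R * (u - 1) ^+ 2 + 6 * L%:R * c ^+ 2.
  have : L%:R * nsq xi <= L%:R * c ^+ 2 by rewrite ler_wpM2l.
  by move: lo up h; nra.
move: c2 L1 => h1 h2; move=> /(lerD (lexx 1)); rewrite [1 + nsq _]addrC => /le_trans; apply.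
rewrite /rho.
have A : (u - 1) ^+ 2 <= c ^+ 2 * (u - 1) ^+ 2 by have := sqr_ge0 (u - 1); nra.
have C : 1 <= L%:R * c ^+ 2 by nra.
have D : 0 <= L%:R * c ^+ 2 * (u - 1) by apply: mulr_ge0; [apply: mulr_ge0; [lra | exact: sqr_ge0] | lra].
have F : L%:R * (u - 1) ^+ 2 <= L%:R * c ^+ 2 * (u - 1) ^+ 2.
  by rewrite -mulrA; apply: ler_wpM2l => //; lra.
have G : 0 <= L%:R * c ^+ 2 * (u - 1) ^+ 2 by apply: mulr_ge0; [apply: mulr_ge0; [lra | exact: sqr_ge0] | exact: sqr_ge0].
have -> : u ^+ 2 = (u - 1) ^+ 2 + 2 * (u - 1) + 1 by ring.
by lra.
Qed.

(** The descent at step [n] presupposes that [theta n] lies within the radius. The induction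
    hypothesis supplies this, since the accumulated losses are nonnegative and so [lyap] has not
    risen above its initial value. *)
Lemma lyap_trajectory n :
  lyap xi (theta n) +
    2 * L%:R * \sum_(k < n) gamma k * eloss xi Rr (theta k) (m k) (xs k)
  <= lyap xi (theta 0%N).
Proof.
elim: n => [|n IH]; first by rewrite big_ord0 mulr0 addr0.
have S0 k : 0 <= \sum_(k < k) gamma k * eloss xi Rr (theta k) (m k) (xs k).
  by apply: sumr_ge0 => i _; rewrite mulr_ge0 ?eloss_ge0.
have h : lyap xi (theta n) <= lyap xi (theta 0%N).
  apply: le_trans IH; rewrite lerDl mulr_ge0 //; move: L1; lra.
have u1 : 1 <= u by rewrite /u; have := enorm_ge0 (theta 0%N); lra.
have := @lyap_descent R l dd L xi Rr HL Hdd HRinf rho (dd%:R * c ^+ 2)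
  (theta n) (m n) (xs n) (gamma n) (m0 n) (nsq_le_of_lyap h)
  (fun i => nsq_input_le (xsc n i)) (g0 n)
  (step_size_bound HL dd_gt1 c1 u1 (g0 n) (step n)).
rewrite -theta_rec big_ord_recr /= mulrDr.
by lra.
Qed.

Lemma trajectory_bounded n : nsq (theta n) + 1 <= rho.
Proof.
apply: nsq_le_of_lyap; apply: le_trans (lyap_trajectory n).
rewrite lerDl mulr_ge0 //.
by apply: sumr_ge0 => i _; rewrite mulr_ge0 ?eloss_ge0.
Qed.

Lemma weighted_loss_bounded n :
  \sum_(k < n) gamma k * eloss xi Rr (theta k) (m k) (xs k) <= rho.
Proof.
have := lyap_trajectory n; set S := \sum_(k < n) _ => tr.
have lo := lyap_lower xi HL Hdd (theta n).
have up := lyap_upper xi HL Hdd (theta 0%N).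
have := trajectory_bounded 0; have := nsq_ge0 (theta n).
have -> : nsq (theta 0%N) = (u - 1) ^+ 2 by rewrite /u addrK enorm_sqr.
have E : nsq (theta 0%N) = (u - 1) ^+ 2 by rewrite /u addrK enorm_sqr.
have u1 : 1 <= u by rewrite /u; have := enorm_ge0 (theta 0%N); lra.
rewrite E in up => n0 _.
have LS : 2 * L%:R * S <= 2 * L%:R * ((u - 1) ^+ 2 + 2 * c ^+ 2).
  have : L%:R * nsq xi <= L%:R * c ^+ 2 by rewrite ler_wpM2l.
  have : 0 <= L%:R * c ^+ 2 by rewrite mulr_ge0 ?sqr_ge0.
  by move: lo up tr n0; lra.
have : S <= (u - 1) ^+ 2 + 2 * c ^+ 2.
  by rewrite -(ler_pM2l (_ : 0 < 2 * L%:R)) //; move: L1; lra.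
move=> /le_trans; apply; rewrite /rho; move: c2 L1 => h1 h2.
have A : (u - 1) ^+ 2 <= c ^+ 2 * (u - 1) ^+ 2 by have := sqr_ge0 (u - 1); nra.
have A2 : c ^+ 2 * 1 <= c ^+ 2 * u ^+ 2 by rewrite ler_wpM2l ?expr_ge1 //; lra.
have A3 : c ^+ 2 * (u - 1) ^+ 2 <= c ^+ 2 * u ^+ 2.
  by rewrite ler_wpM2l ?lerXn2r ?nnegrE //; lra.
have : c ^+ 2 * u ^+ 2 <= L%:R * (c ^+ 2 * u ^+ 2).
  by rewrite ler_peMl // mulr_ge0 ?sqr_ge0.
by lra.
Qed.

(* The radius is a parameter, so that the constant does not depend on the
   trajectory. *)
Definition increment_const (r : R) : R :=
  let K := dd%:R * c ^+ 2 in
  let B := 4 ^+ L.-1 * r ^+ L.-1 * K in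
  let S := 2 * (r ^+ L * K) + 2 * c ^+ 2 in
  B * (4 * B * S) * (4 * S) + 1.

(** The test point [x] is any point of the box, not one of the samples, so that the bound can later
    be integrated over the law of the data. *)
Lemma trajectory_increment (r1 : R) n (x : 'cV[R]_(l 0%N)) : rho <= r1 ->
  (forall i, `|x i ord0| <= c) ->
  `|sloss xi Rr (theta n.+1) x - sloss xi Rr (theta n) x| <=
     gamma n * increment_const r1.
Proof.
move=> hr xc; rewrite /increment_const.
set K := dd%:R * _; set B := _ * _ ^+ L.-1 * _; set S := _ + 2 * c ^+ 2.
have tb k : nsq (theta k) + 1 <= r1 by apply: le_trans hr; exact: trajectory_bounded.
have r0 : 0 <= r1 by have := tb 0%N; have := nsq_ge0 (theta 0%N); lra.
have K0 : 0 <= K by rewrite mulr_ge0 ?sqr_ge0.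
have B0 : 0 <= B by apply: mulr_ge0 => //; apply: mulr_ge0; exact: exprn_ge0.
have S0 : 0 <= S.
  have rK : 0 <= r1 ^+ L * K by apply: mulr_ge0 => //; exact: exprn_ge0.
  have := sqr_ge0 c; rewrite /S; lra.
have xK (y : 'cV[R]_(l 0%N)) : (forall i, `|y i ord0| <= c) -> 1 + nsq y <= K by exact: nsq_input_le.
have sS (y : 'cV[R]_(l 0%N)) : (forall i, `|y i ord0| <= c) -> sloss xi Rr (theta n) y <= S.
  move=> yc; apply: le_trans (sloss_le xi Hdd HRinf (tb n) (xK _ yc)) _.
  by rewrite lerD2l ler_wpM2l.
have eS : eloss xi Rr (theta n) (m n) (xs n) <= S.
  rewrite /eloss ler_pdivrMl ?ltr0n //; apply: le_trans (_ : \sum_(i < m n) S <= _).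
    by apply: ler_sum => i _; apply: sS; apply: xsc.
  by rewrite sumr_const card_ord mulr_natl.
have gS : nsq (ggrad xi Rr (theta n) (m n) (xs n)) <= 4 * B * S.
  have := @nsq_ggrad_le R l dd L xi Rr HL Hdd HRinf r1 K (theta n) (m n) (xs n)
    (m0 n) (tb n) (fun i => xK _ (xsc n i)).
  move=> /le_trans; apply; rewrite -/B; apply: ler_wpM2l => //.
  by rewrite mulr_ge0.
have D0 : 0 <= 4 * B * S by apply: mulr_ge0 => //; apply: mulr_ge0.
have dn : nsq (theta n.+1 - theta n) <= gamma n ^+ 2 * (4 * B * S).
  rewrite theta_rec addrAC subrr add0r -scaleNr nsqZ sqrrN.
  by rewrite ler_wpM2l ?sqr_ge0.
apply: le_trans (sloss_variation xi HL Hdd HRinf (tb n) (tb n.+1) (xK _ xc) (g0 n) D0 dn) _.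
rewrite ler_wpM2l // lerD2r -/B ler_wpM2l //; first by apply: mulr_ge0.
by move: xic; rewrite /S; lra.
Qed.

End Trajectory.

(** * Gradients of the smoothed losses and their limit *)

Section LineDerivatives.
Variables (R : realType) (l : nat -> nat) (dd : nat) (Rr : \bar R -> R -> R).
Hypothesis HRC1 : forall r : R, 1 <= r -> forall x, derivable (Rr r%:E) x 1.
Implicit Types (th v : 'cV[R]_dd) (x : 'cV[R]_(l 0%N)).

Lemma powR_ge1 (r a : R) : 1 <= r -> 0 <= a -> 1 <= r `^ a.
Proof. by move=> r1 a0; rewrite -(powRr0 r) ler_powR. Qed.

Lemma is_derive_ext (V W : normedModType R) (f g : V -> W) (a v : V) (df dg : W) :
  is_derive a v f df -> f =1 g -> df = dg -> is_derive a v g dg.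
Proof. by move=> H /funext <- <-. Qed.

Lemma is_derive_mulE (f g : R -> R) (a df dg : R) :
  is_derive a 1 f df -> is_derive a 1 g dg ->
  is_derive a 1 (fun h => f h * g h) (df * g a + f a * dg).
Proof.
move=> Hf Hg; apply: (is_derive_ext (is_deriveM Hf Hg)) => //.
by rewrite /GRing.scale /= addrC mulrC.
Qed.

Lemma is_derive_addE (f g : R -> R) (a df dg : R) :
  is_derive a 1 f df -> is_derive a 1 g dg ->
  is_derive a 1 (fun h => f h + g h) (df + dg).
Proof. by move=> Hf Hg; apply: (is_derive_ext (is_deriveD Hf Hg)). Qed.

Lemma is_derive_sumE n (f : 'I_n -> R -> R) (a : R) (df : 'I_n -> R) :
  (forall i, is_derive a 1 (f i) (df i)) ->
  is_derive a 1 (fun h => \sum_i f i h) (\sum_i df i).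
Proof.
move=> H; apply: (is_derive_ext (is_derive_sum H)) => // h.
by rewrite fct_sumE.
Qed.

Lemma is_derive_thc th v p :
  is_derive (0 : R) 1 (fun h : R => thc (h *: v + th) p) (thc v p).
Proof.
have H := is_derive_addE (is_derive_mulE (is_derive_id (0 : R) 1)
            (is_derive_cst (thc v p) (0 : R) 1)) (is_derive_cst (thc th p) (0 : R) 1).
apply: (is_derive_ext H) => [h|]; first by rewrite thc_lin.
by rewrite mulr0 !addr0 mul1r.
Qed.

Lemma is_derive_net (r : R) th v x k i : 1 <= r ->
  is_derive (0 : R) 1 (fun h : R => net l Rr r%:E (h *: v + th) k x i ord0)
    (tnet Rr r%:E th v k x i ord0).
Proof.
move=> r1; elim: k i => [|k IH] i.
  by rewrite mxE; exact: is_derive_cst.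
have Hinp j : is_derive (0 : R) 1
    (fun h : R => inp Rr r%:E (h *: v + th) k x j ord0)
    (dact Rr (eroot r%:E k) (net l Rr r%:E th k x j ord0)
                 * tnet Rr r%:E th v k x j ord0).
  rewrite /inp; case k0: (k == 0%N).
    (* The data do not depend on [h]; the factor [dact], meaningless at layer 0, is multiplied by
       the zero tangent. *)
    move/eqP: k0 => k0; subst k; rewrite [X in _ * X]mxE mulr0.
    exact: is_derive_cst.
  have E : (0 : R) *: v + th = th by rewrite scale0r add0r.
  have r1' : 1 <= r `^ (k%:R)^-1 by apply: powR_ge1 => //; rewrite invr_ge0.
  have Hd : is_derive (net l Rr r%:E ((0 : R) *: v + th) k x j ord0) 1
     (Rr (eroot r%:E k)) (dact Rr (eroot r%:E k) (net l Rr r%:E th k x j ord0)).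
    by rewrite E; apply: DeriveDef; [exact: HRC1 | rewrite /= derive1E].
  apply: (is_derive_ext (is_derive1_comp Hd (IH j))) => // h.
  by rewrite /act mxE.
have H := is_derive_addE (is_derive_thc th v (l k.+1 * l k + i + off l k.+1)%N)
  (is_derive_sumE (fun j => is_derive_mulE
    (is_derive_thc th v (i * l k + j + off l k.+1)%N) (Hinp j))).
apply: (is_derive_ext H) => [h|].
  rewrite netS !mxE; congr (_ + _); apply: eq_bigr => j _.
  by rewrite !mxE.
rewrite /= !mxE -addrA; congr (_ + _); rewrite -big_split /=.
by apply: eq_bigr => j _; rewrite !mxE scale0r add0r.
Qed.

(** A directional derivative sees only the restriction to a line, so the chain rule is needed only
    for functions of one real variable. *)
Lemma derive_line (f : 'cV[R]_dd -> R) th v (df : R) :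
  is_derive (0 : R) 1 (fun h : R => f (h *: v + th)) df -> 'D_v f th = df.
Proof.
move=> H; rewrite -(derive_val (is_derive := H)) /derive /=.
suff -> : (fun h : R => h^-1 *: (f (h *: v + th) - f th)) =
  (fun h : R => h^-1 *: (f ((h *: (1 : R) + 0) *: v + th) - f ((0 : R) *: v + th))) by [].
by apply/funext => h; rewrite addr0 scale0r add0r /GRing.scale /= mulr1.
Qed.

Lemma grad_emp_loss (L : nat) (xi : 'cV[R]_(l L)) dT (T : measurableType dT)
    (M : nat -> nat) (X : nat -> nat -> T -> 'cV[R]_(l 0%N)) n (r : R) th w : 1 <= r ->
  grad (fun t => emp_loss Rr xi M X n r%:E t w) th =
  \col_p ((M n)%:R^-1 * \sum_(m < M n)
     2 * dot (net l Rr r%:E th L (X n m.+1 w) - xi)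
             (tnet Rr r%:E th (delta_mx p ord0) L (X n m.+1 w))).
Proof.
move=> r1; apply/colP => p; rewrite !mxE; apply: derive_line.
set v := delta_mx _ _.
have H := is_derive_mulE (is_derive_cst ((M n)%:R^-1 : R) (0 : R) 1)
  (is_derive_sumE (fun m : 'I_(M n) => is_derive_sumE (fun i : 'I_(l L) =>
    let D := is_derive_addE (is_derive_net th v (X n m.+1 w) i r1)
               (is_derive_cst (- xi i ord0) (0 : R) 1) in
    is_derive_mulE D D))).
apply: (is_derive_ext H) => [h|].
  rewrite /emp_loss; congr (_ * _); apply: eq_bigr => m _.
  by rewrite enorm_sqr; apply: eq_bigr => i _; rewrite !mxE expr2.
rewrite mul0r add0r; congr (_ * _); apply: eq_bigr => m _.
rewrite /dot mulr_sumr; apply: eq_bigr => i _.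
rewrite !mxE scale0r add0r addr0 /cst /=; ring.
Qed.

End LineDerivatives.

Section ActivationLimit.
Variables (R : realType) (l : nat -> nat) (dd : nat) (Rr : \bar R -> R -> R).
Hypothesis HRinf : forall y, Rr +oo%E y = Num.max y 0.
Hypothesis HR0 : forall r : R, 1 <= r -> forall x, x <= (2 * r)^-1 -> Rr r%:E x = 0.
Hypothesis HRle : forall r : R, 1 <= r -> forall y, 0 <= Rr r%:E y <= Num.max y 0.
Hypothesis HRid : forall r : R, 1 <= r -> forall z, r^-1 <= z -> Rr r%:E z = z.
Implicit Types (th v : 'cV[R]_dd) (x : 'cV[R]_(l 0%N)).

Lemma cvg_powR_pinfty (a : R) : 0 < a -> (fun r : R => r `^ a) @ +oo --> +oo.
Proof.
move=> a0; apply/cvgryPge => A.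
have H : 0 < Num.max A 1 by rewrite lt_max ltr01 orbT.
near=> r.
have rA : (Num.max A 1) `^ a^-1 <= r by near: r; apply: nbhs_pinfty_ge; rewrite num_real.
apply: le_trans (_ : Num.max A 1 <= _); first by rewrite le_max lexx.
have : ((Num.max A 1) `^ a^-1) `^ a <= r `^ a.
  have r0 : 0 <= r by exact: le_trans (powR_ge0 _ _) rA.
  by apply: ge0_ler_powR => //; rewrite ?nnegrE ?powR_ge0 // ltW.
by rewrite -powRrM mulVf ?gt_eqF // powRr1 // ltW.
Unshelve. all: by end_near. Qed.

Lemma cvg_powRN_pinfty (a : R) : 0 < a -> (fun r : R => r `^ (- a)) @ +oo --> (0 : R).
Proof.
move=> a0; apply/cvgr0Pnorm_lt => e e0; near=> r.
have rA : e^-1 + 1 <= r `^ a.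
  by near: r; move/cvgryPge : (cvg_powR_pinfty a0); apply.
have ep : 0 < e^-1 by rewrite invr_gt0.
have rp : 0 < r `^ a by apply: lt_le_trans rA; lra.
rewrite powRN ger0_norm ?invr_ge0 ?(ltW rp) //.
rewrite -[e]invrK ltf_pV2 ?posrE //.
by apply: lt_le_trans rA; lra.
Unshelve. all: by end_near. Qed.

(** The smoothed activation agrees with the ReLU beyond [s^-1], and below it both lie between 0 and
    [s^-1]; the ReLU itself is 1-Lipschitz. *)
Lemma act_error (s y z : R) : 1 <= s ->
  `|Rr s%:E y - Num.max z 0| <= s^-1 + `|y - z|.
Proof.
move=> s1; have s0 : 0 < s^-1 by rewrite invr_gt0; lra.
have /andP[A B] := HRle s1 y.
have [C|C] := leP s^-1 y.
  rewrite HRid //; case: (leP z 0) => hz; rewrite ler_norml; last first.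
    by have := ler_norm (y - z); have := ler_norm (z - y); rewrite distrC; lra.
  by have := ler_norm (y - z); lra.
move: B; case: (leP y 0) => hy B; case: (leP z 0) => hz; rewrite ler_norml.
- by have := normr_ge0 (y - z); lra.
- by have := ler_norm (z - y); rewrite distrC; lra.
- by have := normr_ge0 (y - z); lra.
- by have := ler_norm (y - z); have := ler_norm (z - y); rewrite distrC; lra.
Qed.

Lemma affine_coordB m n (b : 'cV[R]_m) (W : 'M[R]_(m, n)) (p q : 'cV[R]_n) i :
  (b + W *m p) i ord0 - (b + W *m q) i ord0 =
  \sum_j W i j * (p j ord0 - q j ord0).
Proof.
rewrite !mxE opprD addrACA subrr add0r -sumrB.
by apply: eq_bigr => j _; rewrite mulrBr.
Qed.

(* The error of the k-th hidden layer is o(r^(-1/k)).  This is why the exponent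
   1/k is used: an inactive neuron then ends up below the threshold
   r^(-1/k)/2, where the derivative of the activation vanishes. *)
Lemma net_error_cvg th x k i :
  (fun r : R => r `^ (k%:R)^-1 *
     (net l Rr r%:E th k x i ord0 - net l Rr +oo%E th k x i ord0)) @ +oo --> (0 : R).
Proof.
elim: k i => [|k IH] i.
  by under eq_fun do rewrite /= subrr mulr0; exact: cvg_cst.
have Hinp j : (fun r : R => r `^ (k.+1%:R)^-1 *
     (inp Rr r%:E th k x j ord0 - inp Rr +oo%E th k x j ord0)) @ +oo --> (0 : R).
  rewrite /inp; case k0: (k == 0%N).
    move/eqP: k0 => k0; subst k.
    by under eq_fun do rewrite /= subrr mulr0; exact: cvg_cst.
  have kp : 0 < k%:R :> R by rewrite ltr0n lt0n k0.
  (* The activation adds an error of at most [r^(-1/k)], while the next layer is rescaled only by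
     [r^(1/(k+1))]; the surplus [r^(-a)] drives the product to 0. *)
  pose a : R := k%:R^-1 - k.+1%:R^-1.
  have a0 : 0 < a.
    by rewrite subr_gt0 ltf_pV2 ?posrE ?ltr_nat ?ltr0n // lt0n k0.
  apply: norm_cvg0; apply: (@squeeze_cvgr _ _ _ _ (fun=> 0)
    (fun r : R => r `^ (- a) * (1 + `|r `^ (k%:R)^-1 *
       (net l Rr r%:E th k x j ord0 - net l Rr +oo%E th k x j ord0)|))).
  - near=> r; rewrite normr_ge0 /= normrM ger0_norm ?powR_ge0 //.
    have r1 : 1 <= r by near: r; apply: nbhs_pinfty_ge; rewrite num_real.
    have s1 : 1 <= r `^ k%:R^-1 by apply: powR_ge1 => //; rewrite invr_ge0 ltW.
    rewrite /act !mxE HRinf.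
    have := @act_error (r `^ k%:R^-1) (net l Rr r%:E th k x j ord0)
                (net l Rr +oo%E th k x j ord0) s1.
    move=> /(ler_wpM2l (powR_ge0 r (k.+1%:R)^-1)) /le_trans; apply.
    have -> : - a = k.+1%:R^-1 - k%:R^-1 by rewrite /a opprB.
    rewrite powRB; last by apply/implyP => _; lra.
    rewrite normrM (ger0_norm (powR_ge0 _ _)).
    set S := r `^ k%:R^-1 in s1 *.
    by rewrite le_eqVlt; apply/orP; left; apply/eqP; field; lra.
  - exact: cvg_cst.
  rewrite -[X in _ --> X](_ : 0 * (1 + `|0 : R|) = 0 :> R); last by rewrite mul0r.
  apply: cvgM; first exact: cvg_powRN_pinfty.
  apply: cvgD; first exact: cvg_cst.
  by apply: cvg_norm; exact: IH.
have E (r : R) : r `^ (k.+1%:R)^-1 *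
     (net l Rr r%:E th k.+1 x i ord0 - net l Rr +oo%E th k.+1 x i ord0) =
   \sum_j weight l k.+1 th i j * (r `^ (k.+1%:R)^-1 *
     (inp Rr r%:E th k x j ord0 - inp Rr +oo%E th k x j ord0)).
  rewrite !netS affine_coordB mulr_sumr; apply: eq_bigr => j _.
  by rewrite mulrCA.
rewrite (funext E).
suff : (fun r : R => \sum_j weight l k.+1 th i j * (r `^ (k.+1%:R)^-1 *
    (inp Rr r%:E th k x j ord0 - inp Rr +oo%E th k x j ord0))) @ +oo
    --> \sum_(j < l k) weight l k.+1 th i j * 0.
  by rewrite [X in _ --> X]big1 // => j _; rewrite mulr0.
apply: cvg_big => [|j _]; first exact: add_continuous.
by apply: cvgM; [exact: cvg_cst | exact: Hinp].
Unshelve. all: by end_near. Qed.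

Lemma net_cvg th x k i :
  (fun r : R => net l Rr r%:E th k x i ord0) @ +oo --> net l Rr +oo%E th k x i ord0.
Proof.
apply/subr_cvg0; apply: norm_cvg0.
apply: (@squeeze_cvgr _ _ _ _ (fun=> 0) (fun r : R => `|r `^ (k%:R)^-1 *
     (net l Rr r%:E th k x i ord0 - net l Rr +oo%E th k x i ord0)|)).
- near=> r; rewrite normr_ge0 /= normrM (ger0_norm (powR_ge0 _ _)).
  have r1 : 1 <= r by near: r; apply: nbhs_pinfty_ge; rewrite num_real.
  by rewrite ler_peMl // powR_ge1 // invr_ge0.
- exact: cvg_cst.
by rewrite -[X in _ --> X](@normr0 _ R); apply: cvg_norm; exact: net_error_cvg.
Unshelve. all: by end_near. Qed.

(** The derivative is eventually constant, not merely convergent. An active neuron ends above the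
    threshold, where the activation is locally the identity; an inactive one, also when its limit is
    exactly 0, ends in the flat zone by [net_error_cvg]. *)
Lemma dact_eventually th x k i : (0 < k)%N ->
  \forall r \near +oo, dact Rr (eroot r%:E k) (net l Rr r%:E th k x i ord0) =
    dact Rr (eroot +oo%E k) (net l Rr +oo%E th k x i ord0).
Proof.
move=> k0; have kp : 0 < k%:R^-1 :> R by rewrite invr_gt0 ltr0n.
set y := net l Rr +oo%E th k x i ord0; rewrite /=.
case: (ltrP 0 y) => hy /=.
  near=> r.
  have r1 : 1 <= r by near: r; apply: nbhs_pinfty_ge; rewrite num_real.
  have s1 : 1 <= r `^ k%:R^-1 by apply: powR_ge1 => //; exact: ltW.
  (* Chosen so that [s^-1 < y / 2]. *)
  have sy : (2 * y^-1) + 1 <= r `^ k%:R^-1.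
    by near: r; move/cvgryPge : (cvg_powR_pinfty kp); apply.
  have ny : y / 2 < net l Rr r%:E th k x i ord0.
    by near: r; apply: (cvgr_gt y); [exact: net_cvg | lra].
  set s := r `^ _ in s1 sy *; set z := net _ _ _ _ _ _ _ _ in ny *.
  have yi : 0 < y^-1 by rewrite invr_gt0.
  have sz : s^-1 < z.
    apply: lt_trans ny; rewrite -[y / 2]invrK ltf_pV2 ?posrE ?invr_gt0 ?divr_gt0 //; last by lra.
    by rewrite invfM invrK; lra.
  rewrite derive1E (@near_eq_derive _ _ _ _ id) ?derive_id //.
  near=> t; apply: HRid => //; apply: ltW.
  by near: t; apply: lt_nbhsr.
near=> r.
have r1 : 1 <= r by near: r; apply: nbhs_pinfty_ge; rewrite num_real.
have s1 : 1 <= r `^ k%:R^-1 by apply: powR_ge1 => //; exact: ltW.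
have ny : `|r `^ k%:R^-1 * (net l Rr r%:E th k x i ord0 - y)| < 2^-1.
  near: r; move/cvgr0Pnorm_lt : (@net_error_cvg th x k i); apply.
  by rewrite invr_gt0.
set s := r `^ _ in s1 ny *; set z := net _ _ _ _ _ _ _ _ in ny *.
have sz : z < (2 * s)^-1.
  rewrite invfM; have := le_lt_trans (ler_norm _) ny.
  rewrite -ltr_pdivlMl; last by lra.
  by rewrite mulrC; lra.
rewrite derive1E (@near_eq_derive _ _ _ _ (cst 0)) ?derive_cst //.
near=> t; apply: HR0 => //; apply: ltW.
by near: t; apply: lt_nbhsl.
Unshelve. all: by end_near. Qed.

Lemma tnet_cvg th v x k i :
  (fun r : R => tnet Rr r%:E th v k x i ord0) @ +oo --> tnet Rr +oo%E th v k x i ord0.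
Proof.
elim: k i => [|k IH] i.
  rewrite [X in _ --> X](_ : _ = 0) ?mxE //.
  rewrite [X in X @ _](_ : _ = cst 0); first exact: cvg_cst.
  by apply/funext => r; rewrite mxE.
have Hd j : (fun r : R => dact Rr (eroot r%:E k) (net l Rr r%:E th k x j ord0)
                 * tnet Rr r%:E th v k x j ord0) @ +oo -->
   dact Rr (eroot +oo%E k) (net l Rr +oo%E th k x j ord0)
                 * tnet Rr +oo%E th v k x j ord0.
  case: (posnP k) => [k0|k0].
    subst k; rewrite [X in _ * X]mxE mulr0.
    by under eq_fun do rewrite [X in _ * X]mxE mulr0; exact: cvg_cst.
  apply: cvgM; last exact: IH.
  apply: cvg_near_cst; exact: dact_eventually.
have Hi j : (fun r : R => inp Rr r%:E th k x j ord0) @ +oo --> inp Rr +oo%E th k x j ord0.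
  rewrite /inp; case k0: (k == 0%N); first exact: net_cvg.
  have kp : 0 < k%:R^-1 :> R by rewrite invr_gt0 ltr0n lt0n k0.
  apply/subr_cvg0; apply: norm_cvg0.
  apply: (@squeeze_cvgr _ _ _ _ (fun=> 0) (fun r : R => r `^ (- k%:R^-1) +
    `|net l Rr r%:E th k x j ord0 - net l Rr +oo%E th k x j ord0|)).
  - near=> r; rewrite normr_ge0 /= /act !mxE HRinf powRN.
    have r1 : 1 <= r by near: r; apply: nbhs_pinfty_ge; rewrite num_real.
    by apply: act_error; apply: powR_ge1 => //; exact: ltW.
  - exact: cvg_cst.
  rewrite -[X in _ --> X](_ : 0 + `|0 : R| = 0 :> R); last by rewrite normr0 addr0.
  apply: cvgD; first exact: cvg_powRN_pinfty.
  by apply: cvg_norm; apply/subr_cvg0; exact: net_cvg.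
rewrite /= mxE; under eq_fun do rewrite /= mxE.
apply: cvgD.
  rewrite mxE; under eq_fun do rewrite mxE.
  apply: cvgD; first exact: cvg_cst.
  rewrite mxE; under eq_fun do rewrite mxE.
  apply: cvg_big => [|j _]; first exact: add_continuous.
  by apply: cvgM; [exact: cvg_cst | exact: Hi].
rewrite mxE; under eq_fun do rewrite mxE.
apply: cvg_big => [|j _]; first exact: add_continuous.
apply: cvgM; first exact: cvg_cst.
by rewrite mxE; under eq_fun do rewrite mxE; exact: Hd.
Unshelve. all: by end_near. Qed.

Lemma cvg_col n (f : R -> 'cV[R]_n) (g : 'cV[R]_n) :
  (forall i, (fun r => f r i ord0) @ +oo --> g i ord0) -> f @ +oo --> g.
Proof.
move=> H; apply/cvgrPdist_le => /= e e0; near=> r.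
rewrite [leLHS]/Num.Def.normr/= mx_normrE (bigmax_le _ (ltW e0))//= => -[i j] _.
rewrite !mxE (ord1 j) /=; move: i; near: r; apply: filter_forall => /= i.
exact: ((cvgrPdist_le _ _).1 (H i)).
Unshelve. all: by end_near. Qed.

Hypothesis HRC1 : forall r : R, 1 <= r -> forall x : R, derivable (Rr r%:E) x 1.

(** Convergence holds at every parameter and every sample point, so the hypothesis on [G] determines
    it without exception. *)
Lemma grad_emp_loss_cvg (L : nat) (xi : 'cV[R]_(l L)) dT (T : measurableType dT)
    (M : nat -> nat) (X : nat -> nat -> T -> 'cV[R]_(l 0%N)) n th w :
  (fun r : R => grad (fun t => emp_loss Rr xi M X n r%:E t w) th) @ +oo -->
  ggrad xi Rr th (M n) (fun m => X n m.+1 w).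
Proof.
pose F (r : R) : 'cV[R]_dd := \col_p ((M n)%:R^-1 * \sum_(m < M n)
     2 * dot (net l Rr r%:E th L (X n m.+1 w) - xi)
             (tnet Rr r%:E th (delta_mx p ord0) L (X n m.+1 w))).
apply: cvg_trans (near_eq_cvg (f := F) _) _.
  near=> r.
  have r1 : 1 <= r by near: r; apply: nbhs_pinfty_ge; rewrite num_real.
  by rewrite /F grad_emp_loss.
apply: cvg_col => p; rewrite /F mxE; under eq_fun do rewrite mxE.
apply: cvgM; first exact: cvg_cst.
apply: cvg_big => [|m _]; first exact: add_continuous.
apply: cvgM; first exact: cvg_cst.
apply: cvg_big => [|i _]; first exact: add_continuous.
rewrite !mxE; under eq_fun do rewrite !mxE.
by apply: cvgM; [apply: cvgD; [exact: net_cvg | exact: cvg_cst] | exact: tnet_cvg].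
Unshelve. all: by end_near. Qed.

End ActivationLimit.

(** * Measurability and independence *)

Section VectorMeasurability.
Variable R : realType.

Definition coord_measurable d (S : measurableType d) n (f : S -> 'cV[R]_n) : Prop :=
  forall i, measurable_fun [set: S] (fun s => f s i ord0).

(** The generator of [vec_borel], named so that [g_sigma_algebraType] can equip column vectors with
    that sigma-algebra. *)
Definition vec_gen n : set (set 'cV[R]_n) :=
  \bigcup_(i in [set: 'I_n])
    preimage_set_system setT (fun x : 'cV[R]_n => x i ord0) measurable.

Lemma vec_measurableP d (S : measurableType d) n (f : S -> 'cV[R]_n) :
  coord_measurable f <->
  measurable_fun [set: S] (f : S -> g_sigma_algebraType (@vec_gen n)).
Proof.
split=> H.
  apply: (@measurability _ _ S (g_sigma_algebraType (@vec_gen n)) setT f (@vec_gen n)) => //.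
  move=> _ [_ [i _ [U mU <-]] <-].
  by rewrite !setTI; have := H i measurableT U mU; rewrite setTI.
move=> i _ U mU; rewrite setTI.
have := H measurableT ((fun x : 'cV[R]_n => x i ord0) @^-1` U); rewrite setTI; apply.
by apply: sub_sigma_algebra; exists i => //; exists U => //; rewrite setTI.
Qed.

Lemma rvec_measurableP d (S : measurableType d) n (f : S -> 'cV[R]_n) :
  rvec_measurable f <-> coord_measurable f.
Proof.
rewrite vec_measurableP; split => [H _ B mB|H B mB]; first by rewrite setTI; exact: H.
by have := H measurableT B mB; rewrite setTI.
Qed.

End VectorMeasurability.

Section NetworkMeasurability.
Variables (R : realType) (l : nat -> nat) (dd : nat) (Rr : \bar R -> R -> R).
Hypothesis HRinf : forall y, Rr +oo%E y = Num.max y 0.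
Context d (S : measurableType d).
Variables (th : S -> 'cV[R]_dd) (x : S -> 'cV[R]_(l 0%N)).
Hypothesis mth : coord_measurable th.
Hypothesis mx : coord_measurable x.

Lemma measurable_thc n (f : S -> 'cV[R]_n) p : coord_measurable f ->
  measurable_fun [set: S] (fun s => thc (f s) p).
Proof.
move=> mf; rewrite /thc; case: insubP => [q _ _|_]; last exact: measurable_cst.
exact: mf.
Qed.

Lemma measurable_mulmx_coord m n (W : S -> 'M[R]_(m, n)) (p : S -> 'cV[R]_n) i :
  (forall i j, measurable_fun [set: S] (fun s => W s i j)) -> coord_measurable p ->
  measurable_fun [set: S] (fun s => (W s *m p s) i ord0).
Proof.
move=> mW mp; under eq_fun do rewrite mxE.
by apply: measurable_sum => j; apply: measurable_funM; [exact: mW | exact: mp].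
Qed.

Lemma measurable_inp k : coord_measurable (fun s => net l Rr +oo%E (th s) k (x s)) ->
  coord_measurable (fun s => inp Rr +oo%E (th s) k (x s)).
Proof.
move=> mn i; under eq_fun do rewrite inp_ooE //; case: (k == 0%N); first exact: mn.
by apply: measurable_maxr; [exact: mn | exact: measurable_cst].
Qed.

(** The underlying space is arbitrary because three are needed: the sample space, the same set with
    the sigma-algebra of the past, and a product of two vector spaces. *)
Lemma measurable_net k : coord_measurable (fun s => net l Rr +oo%E (th s) k (x s)).
Proof.
elim: k => [|k IH] i; first exact: mx.
under eq_fun do rewrite netS mxE; apply: measurable_funD.
  by under eq_fun do rewrite mxE; exact: measurable_thc.
apply: measurable_mulmx_coord; last exact: measurable_inp.
by move=> i' j; under eq_fun do rewrite mxE; exact: measurable_thc.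
Qed.

Lemma measurable_tnet v k : coord_measurable (fun s => tnet Rr +oo%E (th s) v k (x s)).
Proof.
elim: k => [|k IH] i; first by under eq_fun do rewrite mxE; exact: measurable_cst.
under eq_fun do rewrite /= mxE; apply: measurable_funD.
  under eq_fun do rewrite mxE; apply: measurable_funD; first exact: measurable_cst.
  apply: measurable_mulmx_coord; first by move=> *; exact: measurable_cst.
  by apply: measurable_inp; exact: measurable_net.
apply: measurable_mulmx_coord.
  by move=> i' j; under eq_fun do rewrite mxE; exact: measurable_thc.
move=> j; under eq_fun do rewrite mxE; apply: measurable_funM; last exact: IH.
have -> : (fun s => (0 < net l Rr +oo%E (th s) k (x s) j ord0)%R%:R) =
    (\1_(`]0%R, +oo[ : set R) : R -> R) \o
      (fun s => net l Rr +oo%E (th s) k (x s) j ord0).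
  by apply/funext => s; rewrite /= indicE mem_setE in_itv /= andbT.
apply: measurableT_comp; last exact: measurable_net.
by apply: measurable_indic; exact: measurable_itv.
Qed.

Variables (L : nat) (xi : 'cV[R]_(l L)).

Lemma measurable_net_sub :
  coord_measurable (fun s => net l Rr +oo%E (th s) L (x s) - xi).
Proof.
move=> i; under eq_fun do rewrite mxE.
by apply: measurable_funD; [exact: measurable_net | exact: measurable_cst].
Qed.

Lemma measurable_sloss : measurable_fun [set: S] (fun s => sloss xi Rr (th s) (x s)).
Proof.
by apply: measurable_sum => i; apply: measurable_funX; exact: measurable_net_sub.
Qed.

Lemma measurable_gdir v : measurable_fun [set: S] (fun s => gdir xi Rr (th s) v (x s)).
Proof.
apply: measurable_funM; first exact: measurable_cst.
apply: measurable_sum => i; apply: measurable_funM; first exact: measurable_net_sub.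
exact: measurable_tnet.
Qed.

End NetworkMeasurability.

(** Measurability is asked only of the samples in the batch, since these are the ones that the past
    sigma-algebra contains. *)
Lemma measurable_ggrad (R : realType) (l : nat -> nat) (dd : nat)
    (Rr : \bar R -> R -> R) d (S : measurableType d) (th : S -> 'cV[R]_dd)
    (xs : S -> nat -> 'cV[R]_(l 0%N)) (L : nat) (xi : 'cV[R]_(l L)) m :
  (forall y, Rr +oo%E y = Num.max y 0) -> coord_measurable th ->
  (forall i, (i < m)%N -> coord_measurable (fun s => xs s i)) ->
  coord_measurable (fun s => ggrad xi Rr (th s) m (xs s)).
Proof.
move=> HRinf mth mxs p; under eq_fun do rewrite mxE.
apply: measurable_funM; first exact: measurable_cst.
by apply: measurable_sum => i; apply: measurable_gdir => //; exact: mxs.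
Qed.

Section IndependentFubini.
Context d d1 d2 (T : measurableType d) (T1 : measurableType d1) (T2 : measurableType d2).
Variables (R : realType) (P : probability T R).
Variables (f : T -> T1) (g : T -> T2).
Hypotheses (mf : measurable_fun [set: T] f) (mg : measurable_fun [set: T] g).
Hypothesis indep : forall A B, measurable A -> measurable B ->
  P (f @^-1` A `&` g @^-1` B) = (P (f @^-1` A) * P (g @^-1` B))%E.

Let f_mixin := isMeasurableFun.Build _ _ _ _ _ mf.
Let g_mixin := isMeasurableFun.Build _ _ _ _ _ mg.
Let F : {mfun T >-> T1} := HB.pack f f_mixin.
Let G : {mfun T >-> T2} := HB.pack g g_mixin.

Local Open Scope ereal_scope.

(** By independence the law of the pair agrees with the product of the laws on rectangles, hence
    everywhere. Tonelli then lets the second component run over its own copy of the probability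
    space. *)
Lemma integral_indep_pair (h : T1 * T2 -> \bar R) :
  measurable_fun setT h -> (forall z, 0 <= h z) ->
  \int[P]_w h (f w, g w) = \int[P]_w \int[P]_w' h (f w, g w').
Proof.
move=> mh h0.
have mfg := measurable_fun_pair mf mg.
pose FG : {mfun T >-> (T1 * T2)%type} :=
  HB.pack (fun w => (f w, g w)) (isMeasurableFun.Build _ _ _ _ _ mfg).
transitivity (\int[distribution P FG]_z h z).
  by rewrite (ge0_integral_pushforward mfg).
transitivity (\int[distribution P F \x distribution P G]_z h z).
  apply: eq_measure_integral => A mA _; apply/esym.
  by apply: (product_measure_unique _ mA) => A1 A2 mA1 mA2; exact: (indep mA1 mA2).
rewrite fubini_tonelli1 // /fubini_F.
rewrite (ge0_integral_pushforward mf) //; last 2 first.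
- exact: (measurable_fun_fubini_tonelli_F h).
- by move=> y _; exact: integral_ge0.
rewrite preimage_setT; apply: eq_integral => w _ /=.
rewrite (ge0_integral_pushforward mg) //.
by apply: measurableT_comp => //; exact: measurable_pair1.
Qed.

End IndependentFubini.

Section SigmaRv.
Variable R : realType.

Lemma vec_borelT n : @vec_borel R n setT.
Proof. exact: (@measurableT _ (g_sigma_algebraType (@vec_gen R n))). Qed.

Lemma sigma_rvT d (T : measurableType d) n (f : T -> 'cV[R]_n) : sigma_rv f setT.
Proof. by exists setT => //; exact: vec_borelT. Qed.

Lemma sigma_rvI d (T : measurableType d) n (f : T -> 'cV[R]_n) : setI_closed (sigma_rv f).
Proof.
move=> _ _ [A mA ->] [B mB ->]; exists (A `&` B) => //.
exact: (@measurableI _ (g_sigma_algebraType (@vec_gen R n))).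
Qed.

End SigmaRv.

Lemma bigcap_cons (I : eqType) (T : Type) (i : I) (s : seq I) (E : I -> set T) :
  \bigcap_(j in [set x | x \in i :: s]) E j =
  E i `&` \bigcap_(j in [set x | x \in s]) E j.
Proof.
rewrite eqEsubset; split=> [w H|w [H1 H2] j].
  by split=> [|j js]; apply: H; rewrite /= inE ?eqxx // js orbT.
by rewrite /= inE => /orP[/eqP -> //|js]; exact: H2.
Qed.

Section SampleIndependence.
Variables (R : realType) (l : nat -> nat) (dd : nat).
Context d (T : measurableType d) (P : probability T R).
Variables (X : nat -> nat -> T -> 'cV[R]_(l 0%N)) (Theta0 : T -> 'cV[R]_dd).
Hypothesis HXiid : iid P (fun nm : nat * nat => X nm.1 nm.2).
Hypothesis mTheta0 : rvec_measurable Theta0.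
Hypothesis Hindep : indep2 P (sigma_rv Theta0)
  (sigma_family (fun nm : nat * nat => X nm.1 nm.2)).
Variable M : nat -> nat.

Definition past_indices n : seq (nat * nat) :=
  [seq (j, m.+1) | j <- iota 0 n, m <- iota 0 (M j)].

Lemma past_indicesP n j m : ((j, m) \in past_indices n) = [&& j < n, 0 < m & m <= M j]%N.
Proof.
apply/allpairsPdep/and3P => [[x [y [xi yi [-> ->]]]]|[jn m0 mM]].
  by move: xi yi; rewrite !mem_iota /= add0n.
by exists j, m.-1; rewrite !mem_iota /= !add0n prednK.
Qed.

Lemma past_indices_uniq n : uniq (past_indices n).
Proof.
apply: allpairs_uniq_dep; first exact: iota_uniq.
  by move=> j _; exact: iota_uniq.
by move=> [a b] [a' b'] _ _ /= [-> ->].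
Qed.

(* A pi-system generating the sigma-algebra of the initial value and of the
   samples drawn before time n. *)
Definition past_pi n : set (set T) :=
  [set A | exists A0 (E : nat * nat -> set T),
     [/\ sigma_rv Theta0 A0, (forall j, sigma_rv (X j.1 j.2) (E j)) &
      A = A0 `&` \bigcap_(j in [set x | x \in past_indices n]) E j]].

Lemma past_piI n : setI_closed (past_pi n).
Proof.
move=> _ _ [A0 [E [hA hE ->]]] [B0 [F [hB hF ->]]].
exists (A0 `&` B0), (fun j => E j `&` F j); split.
- exact: sigma_rvI.
- by move=> j; exact: sigma_rvI.
by rewrite bigcapI setIACA.
Qed.

Lemma past_piT n : past_pi n setT.
Proof.
exists setT, (fun=> setT); split; [exact: sigma_rvT | by move=> j; exact: sigma_rvT |].
by rewrite setTI; apply/esym; rewrite -subTset => w _ j _.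
Qed.

Lemma past_pi_Theta0 n A : sigma_rv Theta0 A -> past_pi n A.
Proof.
move=> hA; exists A, (fun=> setT); split=> //; first by move=> j; exact: sigma_rvT.
rewrite [X in _ `&` X](_ : _ = setT) ?setIT //.
by rewrite -subTset => w _ j _.
Qed.

Lemma past_pi_X n j A : j \in past_indices n -> sigma_rv (X j.1 j.2) A -> past_pi n A.
Proof.
move=> jn hA; exists setT, (fun i => if i == j then A else setT); split.
- exact: sigma_rvT.
- by move=> i; case: eqP => [->//|_]; exact: sigma_rvT.
rewrite setTI eqEsubset; split=> [w Aw i _|w]; first by case: eqP.
by move=> /(_ j jn); rewrite eqxx.
Qed.

Lemma sigma_X_measurable j A : sigma_rv (X j.1 j.2) A -> measurable A.
Proof. by case: HXiid => mX _ [B vB ->]; exact: (mX j). Qed.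

Lemma past_pi_measurable n : past_pi n `<=` measurable.
Proof.
move=> _ [A0 [E [[B vB ->] hE ->]]]; apply: measurableI; first exact: mTheta0.
apply: fin_bigcap_measurable => [|j _]; first exact: finite_seq.
exact: (@sigma_X_measurable j).
Qed.

Lemma sigma_family_bigcap (s : seq (nat * nat)) (E : nat * nat -> set T) :
  (forall j, sigma_rv (X j.1 j.2) (E j)) ->
  sigma_family (fun nm : nat * nat => X nm.1 nm.2)
    (\bigcap_(j in [set x | x \in s]) E j).
Proof.
move=> hE.
pose GT := g_sigma_algebraType
  (\bigcup_(i in [set: nat * nat]) sigma_rv ((fun nm : nat * nat => X nm.1 nm.2) i)).
apply: (@fin_bigcap_measurable _ GT) => [|j _]; first exact: finite_seq.
by apply: sub_sigma_algebra; exists j.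
Qed.

Local Open Scope ereal_scope.

(** A pi-lambda argument: the measures [A |-> P (A & D)] and [A |-> P D * P A] have finite mass and
    agree on the generating pi-system. *)
Lemma past_independent n m A D : <<s past_pi n >> A -> sigma_rv (X n m) D ->
  P (A `&` D) = P A * P D.
Proof.
move=> sA hD.
have mD : measurable D by exact: (@sigma_X_measurable (n, m)).
have PDfin : P D \is a fin_num by exact: fin_num_measure.
(* [mscale] scales by a nonnegative real, hence the passage through [fine]. *)
pose r : {nonneg R} := NngNum (fine_ge0 (measure_ge0 P D)).
have rE : r%:num%:E = P D by rewrite /= fineK.
suff H : mrestr P mD A = mscale r P A.
  by move: H; rewrite /mrestr /mscale rE muleC.
apply: (@g_sigma_algebra_measure_unique _ R T (past_pi n) (@past_pi_measurable n)
  (fun=> setT)) => //.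
- by move=> _; exact: past_piT.
- by rewrite bigcup_const //; exists 0%N.
- exact: past_piI.
- move=> B [A0 [E [hA hE BE]]].
  rewrite [LHS](_ : _ = P (B `&` D)) // [RHS](_ : _ = r%:num%:E * P B) // rE BE.
  (* The index [(n, m)] is not in the past, so [D] can be inserted there without altering the
     intersection, and mutual independence applies to the list extended by [(n, m)]. *)
  pose E' j := if j == (n, m) then D else E j.
  have hE' j : sigma_rv (X j.1 j.2) (E' j) by rewrite /E'; case: eqP => [->|].
  have notin : (n, m) \notin past_indices n by rewrite past_indicesP ltnn.
  have EE' : \bigcap_(j in [set x | x \in past_indices n]) E j =
             \bigcap_(j in [set x | x \in past_indices n]) E' j.
    apply: eq_bigcapr => j /= jn; rewrite /E'; case: eqP => // jnm.
    by move: notin; rewrite -jnm jn.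
  have [_ [mutual _]] := HXiid.
  have U := mutual ((n, m) :: past_indices n) E'.
  rewrite /= notin past_indices_uniq in U.
  have {}U := U isT (fun j _ => hE' j).
  have V := mutual (past_indices n) E' (past_indices_uniq n) (fun j _ => hE' j).
  have DE : D = E' (n, m) by rewrite /E' eqxx.
  rewrite EE' -setIA [X in _ `&` X]setIC {1}DE -bigcap_cons.
  rewrite Hindep //; last exact: sigma_family_bigcap.
  rewrite U big_cons -DE Hindep //; last exact: sigma_family_bigcap.
  by rewrite V muleCA.
- by move=> _; rewrite [ltLHS](_ : _ = P (setT `&` D)) // setTI ltey_eq fin_num_measure.
Qed.

End SampleIndependence.

(** * Vanishing of a slowly varying sequence with finite weighted sum *)

Section WeightedVanishing.
Variables (R : realType) (g e : nat -> R) (C B : R).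
Hypothesis g0 : forall n, 0 <= g n.
Hypothesis e0 : forall n, 0 <= e n.
Hypothesis C0 : 0 <= C.
Hypothesis gdiv : (\sum_(0 <= k <oo) (g k)%:E)%E = +oo%E.
Hypothesis geB : forall n, \sum_(k < n) g k * e k <= B.
Hypothesis einc : forall n, `|e n.+1 - e n| <= g n * C.

Lemma divergent_partial_sums (A : R) : exists n, A < \sum_(k < n) g k.
Proof.
apply/not_existsP => H; have : (\sum_(0 <= k <oo) (g k)%:E <= A%:E)%E.
  apply: lime_le.
    by apply: is_cvg_nneseries => n _ _; rewrite lee_fin.
  near=> n; rewrite sumEFin lee_fin big_mkord leNgt.
  by apply/negP; exact: H.
by rewrite gdiv leye_eq.
Unshelve. all: by end_near. Qed.

(* Each descent of e from 2h to below h costs at least h^2 / C of the finite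
   budget sum g e; hence after some time e stays below 2h. *)
Lemma weighted_vanishing : e @ \oo --> (0 : R).
Proof.
pose S n := \sum_(k < n) g k * e k.
have SS n : S n.+1 = S n + g n * e n by rewrite /S big_ord_recr.
have Snd : nondecreasing_seq S.
  by apply/nondecreasing_seqP => n; rewrite SS lerDl mulr_ge0.
have Scvg : cvgn S.
  by apply: nondecreasing_is_cvgn => //; exists B => _ [n _ <-]; exact: geB.
have Sle n : S n <= limn S by exact: nondecreasing_cvgn_le.
apply/cvgr0Pnorm_lt => eps eps0.
pose h := eps / 2; have h0 : 0 < h by rewrite divr_gt0.
pose C' := C + 1; have C'0 : 0 < C' by move: C0; rewrite /C'; lra.
have d0 : 0 < h ^+ 2 / C' by rewrite divr_gt0 // exprn_gt0.
near=> n.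
have Sn : limn S - h ^+ 2 / C' < S n.
  by near: n; apply: (cvgr_gt (limn S)) => //; lra.
(* While [e] stays above [h], the budget spent controls both the drop of [e] and the elapsed sum of
   the weights. *)
have inv j : (forall k, (n <= k < n + j)%N -> h <= e k) ->
    h * (e n - e (n + j)%N) <= C' * (S (n + j)%N - S n) /\
    h * (\sum_(k < n + j) g k - \sum_(k < n) g k) <= S (n + j)%N - S n.
  elim: j => [|j IH] H; first by rewrite addn0 !subrr !mulr0.
  have [|IH1 IH2] := IH; first by move=> k /andP[nk kj]; apply: H; lia.
  have hj : h <= e (n + j)%N by apply: H; lia.
  rewrite addnS SS big_ord_recr /=.
  have gh : h * g (n + j)%N <= g (n + j)%N * e (n + j)%N.
    by rewrite mulrC ler_wpM2l.
  have ij := le_trans (ler_norm _) (einc (n + j)%N).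
  have ij2 : e (n + j)%N - e (n + j).+1 <= g (n + j)%N * C'.
    have := einc (n + j)%N; rewrite distrC => /(le_trans (ler_norm _)).
    by have := g0 (n + j)%N; rewrite /C'; lra.
  split; last by lra.
  have := ler_wpM2l (ltW h0) ij2; have := ler_wpM2l (ltW C'0) gh; lra.
(* If [e] never fell below [h], the divergent sum of the weights would exhaust the budget [B]. *)
have ex : exists m, (n <= m)%N && (e m < h).
  apply: contrapT => nex.
  have [m Hm] := divergent_partial_sums (\sum_(k < n) g k + h^-1 * B).
  have [|_] := inv m.
    move=> k /andP[nk _]; rewrite leNgt; apply/negP => ek.
    by apply: nex; exists k; rewrite nk ek.
  have : S (n + m)%N - S n <= B.
    have := geB (n + m)%N; rewrite -/(S _).
    have : 0 <= S n by apply: sumr_ge0 => i _; rewrite mulr_ge0.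
    by lra.
  move=> SB /le_trans => /(_ _ SB).
  rewrite -ler_pdivlMl //.
  have : \sum_(k < m) g k <= \sum_(k < n + m) g k.
    rewrite -!(big_mkord xpredT g) (@big_cat_nat _ _ _ m 0 (n + m)) ?leq_addl //=.
    by rewrite lerDl; apply: sumr_ge0.
  by lra.
have nm := ex_minnP ex; case: nm => m /andP[nm em] mmin.
have [|H _] := inv (m - n)%N.
  move=> k; rewrite subnKC // => /andP[nk km]; rewrite leNgt; apply/negP => ek.
  by have := mmin k; rewrite nk ek => /(_ isT); rewrite leqNgt km.
move: H; rewrite subnKC // => H.
rewrite ger0_norm //.
(* At the first such [m], less than [h^2 / C'] of the budget remains to be spent, so
   [e n < e m + h < 2 h = eps]. *)
have : C' * (S m - S n) < h ^+ 2.
  by rewrite mulrC -ltr_pdivlMr //; have := Sle m; lra.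
move=> /(le_lt_trans H); rewrite expr2 ltr_pM2l // => H3.
have he : eps = h + h by rewrite /h; field.
by rewrite he; lra.
Unshelve. all: by end_near. Qed.

End WeightedVanishing.

Section ProbabilityIntegral.
Context d (T : measurableType d) (R : realType) (P : probability T R).
Local Open Scope ereal_scope.

Lemma integral_le_addr (f g : T -> R) (k : R) :
  measurable_fun [set: T] f -> measurable_fun [set: T] g ->
  (forall w, 0 <= f w)%R -> (forall w, 0 <= g w)%R -> (0 <= k)%R ->
  (forall w, f w <= g w + k)%R ->
  \int[P]_w (f w)%:E <= \int[P]_w (g w)%:E + k%:E.
Proof.
move=> mf mg f0 g0 k0 fg.
have -> : k%:E = \int[P]_(w in setT) (cst k%:E) w.
  rewrite integral_cst // -[LHS]mule1; congr (_ * _).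
  exact/esym/probability_setT.
have mf' : measurable_fun [set: T] (fun w => (f w)%:E) by exact/measurable_EFinP.
have mg' : measurable_fun [set: T] (fun w => (g w)%:E) by exact/measurable_EFinP.
have mk : measurable_fun [set: T] (cst k%:E) by exact: measurable_cst.
have f0' w : [set: T] w -> 0 <= (f w)%:E by rewrite lee_fin.
have g0' w : [set: T] w -> 0 <= (g w)%:E by rewrite lee_fin.
have k0' w : [set: T] w -> 0 <= cst k%:E w by rewrite lee_fin.
rewrite -ge0_integralD //.
apply: ge0_le_integral => // [|w _]; first exact: emeasurable_funD.
by rewrite /= -EFinD lee_fin.
Qed.

Lemma integral_EFin_bounded (f : T -> R) (k : R) :
  measurable_fun [set: T] f -> (forall w, 0 <= f w <= k)%R ->
  \int[P]_w (f w)%:E = (fine (\int[P]_w (f w)%:E))%:E.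
Proof.
move=> mf fk; rewrite fineK // ge0_fin_numE; last first.
  by apply: integral_ge0 => w _; rewrite lee_fin; case/andP: (fk w).
have f0 w : (0 <= f w)%R by case/andP: (fk w).
have k0 : (0 <= k)%R by case/andP: (fk point) => /le_trans; apply.
apply: le_lt_trans (@integral_le_addr f (cst 0%R) k mf _ f0 _ k0 _) _ => //.
- by move=> w; rewrite add0r; case/andP: (fk w).
by rewrite integral0_eq // add0e ltry.
Qed.

Lemma ae_probability1 (A : set T) : measurable A -> {ae P, forall w, A w} -> P A = 1.
Proof.
move=> mA [N [mN PN sN]].
have : P (~` A) <= 0.
  by rewrite -PN; apply: le_measure => //; rewrite inE //; exact: measurableC.
rewrite probability_setC // => H.
apply/eqP; rewrite eq_le probability_le1 //=.
by move: H; rewrite sube_le0.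
Qed.

End ProbabilityIntegral.

Lemma cvg_limn_esup_EFin (R : realType) (u : nat -> R) (a : R) :
  u @ \oo --> a -> limn_esup (fun n => (u n)%:E) = a%:E.
Proof.
move=> ua; have H : (fun n => (u n)%:E) @ \oo --> a%:E by apply: cvg_EFin => //; near=> n.
by rewrite is_cvg_limn_esupE; [exact/cvg_lim | apply/cvg_ex; exists a%:E].
Unshelve. all: by end_near. Qed.

(** * Convergence of the random trajectory in mean and almost surely *)

Section Sgd.
Variables (R : realType) (L dd : nat) (l : nat -> nat) (xi : 'cV[R]_(l L)).
Variable Rr : \bar R -> R -> R.
Hypothesis HL : (0 < L)%N.
Hypothesis Hl : forall k, (0 < l k)%N.
Hypothesis Hdd : dd = off l L.+1.
Hypothesis HRinf : forall y, Rr +oo%E y = Num.max y 0.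
Context d (T : measurableType d) (P : probability T R).
Variable X : nat -> nat -> T -> 'cV[R]_(l 0%N).
Hypothesis HXiid : iid P (fun nm : nat * nat => X nm.1 nm.2).
Variable c : R.
Hypothesis c1 : 1 <= c.
Hypothesis xic : nsq xi <= c ^+ 2.
Hypothesis Xc : forall n m w i, `|X n m w i ord0| <= c.
Variable M : nat -> nat.
Hypothesis M0 : forall n, (0 < M n)%N.
Variables (Theta : nat -> T -> 'cV[R]_dd) (gamma : nat -> R).
Hypothesis mTheta0 : rvec_measurable (Theta 0%N).
Hypothesis g0 : forall n, 0 <= gamma n.
Hypothesis Hindep : indep2 P (sigma_rv (Theta 0%N))
  (sigma_family (fun nm : nat * nat => X nm.1 nm.2)).
Let sample n w m := X n m.+1 w.
Hypothesis Theta_rec : forall n w,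
  Theta n.+1 w = Theta n w - gamma n *: ggrad xi Rr (Theta n w) (M n) (sample n w).
Hypothesis step : forall n w,
  (4 * L%:R * dd%:R * c) ^+ (2 * L) * gamma n <=
    ((enorm (Theta 0%N w) + 1) ^+ (2 * L))^-1.
Hypothesis gdiv : (\sum_(0 <= k <oo) (gamma k)%:E)%E = +oo%E.

Let rad w := 7 * L%:R * c ^+ 2 * (enorm (Theta 0%N w) + 1) ^+ 2.

(* Some step size is positive, and the step size condition for that index bounds
   the initial value. *)
Lemma radius_bounded : exists r, forall w, rad w <= r.
Proof.
have [n gn] : exists n, 0 < gamma n.
  apply/not_existsP => H.
  have gz k : gamma k = 0.
    by apply/eqP; rewrite eq_le g0 andbT leNgt; apply/negP; exact: H.
  by move: gdiv; rewrite eseries0 // => k _ _; rewrite gz.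
have A0 : 0 < (4 * L%:R * dd%:R * c) ^+ (2 * L).
  apply: exprn_gt0; apply: mulr_gt0; last by move: c1; lra.
  apply: mulr_gt0; last by rewrite ltr0n; exact: ltnW (dd_gt1 HL Hl Hdd).
  by apply: mulr_gt0 => //; rewrite ltr0n.
set A := _ ^+ _ in A0.
have Ag : 0 < A * gamma n by exact: mulr_gt0.
exists (7 * L%:R * c ^+ 2 * ((A * gamma n)^-1) ^+ 2) => w.
rewrite /rad; have u1 : 1 <= enorm (Theta 0%N w) + 1.
  by have := enorm_ge0 (Theta 0%N w); lra.
set u := enorm _ + 1 in u1 *.
have up : 0 < u by lra.
have : u <= (A * gamma n)^-1.
  apply: le_trans (_ : u ^+ (2 * L) <= _).
    by rewrite -[leLHS]expr1 ler_weXn2l // muln_gt0.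
  rewrite -[leLHS]invrK lef_pV2 ?posrE ?invr_gt0 ?exprn_gt0 //.
  exact: step.
move=> uA; apply: ler_wpM2l; first by apply: mulr_ge0; [exact: mulr_ge0 | exact: sqr_ge0].
by rewrite lerXn2r ?nnegrE ?invr_ge0 // ltW.
Qed.

Variable r : R.
Hypothesis radr : forall w, rad w <= r.

Lemma sgd_bounded n w : nsq (Theta n w) + 1 <= r.
Proof.
apply: le_trans (radr w); rewrite /rad.
exact: (@trajectory_bounded R l dd L xi Rr HL Hl Hdd HRinf c c1 xic
  (fun n => Theta n w) gamma M (fun n => sample n w) (fun n i j => Xc n i.+1 w j)
  M0 g0 (fun n => Theta_rec n w) (fun n => step n w) n).
Qed.

Lemma sgd_weighted_loss n w :
  \sum_(k < n) gamma k * eloss xi Rr (Theta k w) (M k) (sample k w) <= r.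
Proof.
apply: le_trans (radr w); rewrite /rad.
exact: (@weighted_loss_bounded R l dd L xi Rr HL Hl Hdd HRinf c c1 xic
  (fun n => Theta n w) gamma M (fun n => sample n w) (fun n i j => Xc n i.+1 w j)
  M0 g0 (fun n => Theta_rec n w) (fun n => step n w) n).
Qed.

Let K := increment_const dd L c r.

Lemma sgd_increment n w (x : 'cV[R]_(l 0%N)) : (forall i, `|x i ord0| <= c) ->
  `|sloss xi Rr (Theta n.+1 w) x - sloss xi Rr (Theta n w) x| <= gamma n * K.
Proof.
move=> xc.
exact: (@trajectory_increment R l dd L xi Rr HL Hl Hdd HRinf c c1 xic
  (fun n => Theta n w) gamma M (fun n => sample n w) (fun n i j => Xc n i.+1 w j)
  M0 g0 (fun n => Theta_rec n w) (fun n => step n w) r n x (radr w) xc).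
Qed.

Let Sb := 2 * (r ^+ L * (dd%:R * c ^+ 2)) + 2 * nsq xi.

Lemma sgd_sloss_bounded n w (x : 'cV[R]_(l 0%N)) : (forall i, `|x i ord0| <= c) ->
  0 <= sloss xi Rr (Theta n w) x <= Sb.
Proof.
move=> xc; rewrite sloss_ge0 /=.
apply: (sloss_le xi Hdd HRinf (sgd_bounded n w)).
exact: (nsq_input_le HL Hl Hdd c1 xc).
Qed.

Let mX n m : coord_measurable (X n m).
Proof. by apply/rvec_measurableP; case: HXiid => H _; exact: (H (n, m)). Qed.

(** [Theta n] is a function of the initial value and of the batches before time [n]. The horizon [N]
    is fixed so that the induction runs inside one sigma-algebra. *)
Lemma Theta_past_measurable N n : (n <= N)%N ->
  @coord_measurable R _ (g_sigma_algebraType (past_pi X (Theta 0%N) M N)) dd (Theta n).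
Proof.
elim: n => [|n IH] nN.
  apply/rvec_measurableP => B vB; apply: sub_sigma_algebra.
  by apply: past_pi_Theta0; exists B.
move=> i; under eq_fun do rewrite Theta_rec !mxE.
apply: measurable_funB; first exact: IH (ltnW nN) i.
apply: measurable_funM; first exact: measurable_cst.
have := @measurable_ggrad R l dd Rr _ (g_sigma_algebraType (past_pi X (Theta 0%N) M N))
  (Theta n) (sample n) L xi (M n) HRinf (IH (ltnW nN)).
have mS j : (j < M n)%N ->
    @coord_measurable R _ (g_sigma_algebraType (past_pi X (Theta 0%N) M N)) _
      (fun s => sample n s j).
  move=> jM; apply/rvec_measurableP => B vB; apply: sub_sigma_algebra.
  apply: (@past_pi_X _ _ _ _ _ _ _ _ _ (n, j.+1)); last by exists B.
  by rewrite past_indicesP nN.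
by move=> /(_ mS i); under eq_fun do rewrite mxE.
Qed.

Lemma Theta_indep n m A D : vec_borel A -> vec_borel D ->
  P (Theta n @^-1` A `&` X n m @^-1` D) = (P (Theta n @^-1` A) * P (X n m @^-1` D))%E.
Proof.
move=> mA mD.
apply: (past_independent HXiid mTheta0 Hindep (M := M) (n := n) (m := m)); last by exists D.
have /rvec_measurableP := Theta_past_measurable (leqnn n); exact.
Qed.

Lemma mTheta n : coord_measurable (Theta n).
Proof.
apply/rvec_measurableP => B vB.
have /rvec_measurableP H := Theta_past_measurable (leqnn n).
have := H B vB; apply: smallest_sub; first exact: sigma_algebra_measurable.
exact: (past_pi_measurable HXiid mTheta0).
Qed.

Let mean_loss n w := (\int[P]_w' (sloss xi Rr (Theta n w) (X 0%N 0%N w'))%:E)%E.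

Lemma pop_lossE n w : mean_loss n w = (pop_loss Rr xi P X (Theta n w))%:E.
Proof.
rewrite /pop_loss unlock /mean_loss.
under [in RHS]eq_integral do rewrite enorm_sqr.
apply: (@integral_EFin_bounded _ _ _ _ _ Sb).
  by apply: measurable_sloss.
by move=> w'; apply: sgd_sloss_bounded; exact: Xc.
Qed.

Let el n w := pop_loss Rr xi P X (Theta n w).

Let msl n w : measurable_fun [set: T] (fun w' => sloss xi Rr (Theta n w) (X 0%N 0%N w')).
Proof. by apply: measurable_sloss. Qed.

Lemma pop_loss_ge0 n w : 0 <= el n w.
Proof.
rewrite -lee_fin -pop_lossE; apply: integral_ge0 => w' _.
by rewrite lee_fin sloss_ge0.
Qed.

Lemma Sb_ge0 : 0 <= Sb.
Proof.
have /andP[H1 H2] := sgd_sloss_bounded 0 point (fun i => Xc 0 0 point i).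
exact: le_trans H1 H2.
Qed.

Lemma pop_loss_le n w : el n w <= Sb.
Proof.
rewrite -lee_fin -pop_lossE.
have H := @integral_le_addr _ T R P _ (cst 0) Sb (msl n w) (measurable_cst _)
  (fun _ => sloss_ge0 _ _ _ _) (fun _ => lexx _) Sb_ge0.
apply: le_trans (H _) _; last by rewrite integral0_eq // add0e.
by move=> w'; rewrite add0r; have /andP[] := sgd_sloss_bounded n w (Xc 0 0 w').
Qed.

Lemma K_ge0 n : 0 <= gamma n * K.
Proof. by apply: le_trans (sgd_increment n point (fun i => Xc 0 0 point i)). Qed.

Lemma pop_loss_increment n w : `|el n.+1 w - el n w| <= gamma n * K.
Proof.
have H n1 n2 : (forall w', `|sloss xi Rr (Theta n1 w) (X 0%N 0%N w') -
      sloss xi Rr (Theta n2 w) (X 0%N 0%N w')| <= gamma n * K) ->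
    el n1 w <= el n2 w + gamma n * K.
  move=> h; rewrite -lee_fin EFinD -!pop_lossE; apply: integral_le_addr.
  - exact: msl.
  - exact: msl.
  - by move=> w'; exact: sloss_ge0.
  - by move=> w'; exact: sloss_ge0.
  - exact: K_ge0.
  by move=> w'; have := le_trans (ler_norm _) (h w'); lra.
have H1 := H n.+1 n (fun w' => sgd_increment n w (Xc 0 0 w')).
have H2 : el n w <= el n.+1 w + gamma n * K.
  by apply: H => w'; rewrite distrC; exact: sgd_increment (Xc 0 0 w').
by rewrite ler_norml; lra.
Qed.

Lemma measurable_mean_loss n : measurable_fun [set: T] (mean_loss n).
Proof.
apply: (@measurable_fun_fubini_tonelli_F _ _ T T R P
  (fun z => (sloss xi Rr (Theta n z.1) (X 0%N 0%N z.2))%:E)).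
  apply/measurable_EFinP; apply: measurable_sloss => // i.
    by apply: (measurableT_comp (mTheta n i)); exact: measurable_fst.
  by apply: (measurableT_comp (@mX 0%N 0%N i)); exact: measurable_snd.
by move=> z; rewrite lee_fin sloss_ge0.
Qed.

Lemma measurable_pop_loss n : measurable_fun [set: T] (el n).
Proof.
apply/measurable_EFinP; have := measurable_mean_loss n.
by rewrite (_ : mean_loss n = fun w => (el n w)%:E) //; apply/funext => w; exact: pop_lossE.
Qed.

(** Independence freezes [Theta n] while the sample is integrated out; equality in law then replaces
    [X n m] by the [X 0 0] of the population loss. *)
Lemma integral_sample_loss n m :
  (\int[P]_w (sloss xi Rr (Theta n w) (X n m w))%:E = \int[P]_w (el n w)%:E)%E.
Proof.
under [RHS]eq_integral do rewrite -pop_lossE.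
pose h (z : g_sigma_algebraType (@vec_gen R dd) * g_sigma_algebraType (@vec_gen R (l 0%N))) :=
  (sloss xi Rr z.1 z.2)%:E.
have mfst : @coord_measurable R _ (g_sigma_algebraType (@vec_gen R dd) *
    g_sigma_algebraType (@vec_gen R (l 0%N)))%type dd fst.
  by apply/vec_measurableP; exact: measurable_fst.
have msnd : @coord_measurable R _ (g_sigma_algebraType (@vec_gen R dd) *
    g_sigma_algebraType (@vec_gen R (l 0%N)))%type (l 0%N) snd.
  by apply/vec_measurableP; exact: measurable_snd.
have mh : measurable_fun setT h.
  by apply/measurable_EFinP; exact: (measurable_sloss HRinf mfst msnd).
have h0 z : (0 <= h z)%E by rewrite lee_fin sloss_ge0.
have mT := (vec_measurableP (Theta n)).1 (mTheta n).
have mXn k j := (vec_measurableP (X k j)).1 (@mX k j).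
have := integral_indep_pair mT (mXn n m) (@Theta_indep n m) mh h0.
rewrite /h /= => ->; apply: eq_integral => w _; rewrite /mean_loss.
pose hw (y : g_sigma_algebraType (@vec_gen R (l 0%N))) := (sloss xi Rr (Theta n w) y)%:E.
have mhw : measurable_fun setT hw.
  apply/measurable_EFinP; apply: measurable_sloss => //.
  by apply/vec_measurableP; exact: measurable_id.
have hw0 : {in setT, forall y, (0 <= hw y)%E} by move=> y _; rewrite lee_fin sloss_ge0.
transitivity (\int[pushforward P (X n m : T -> g_sigma_algebraType (@vec_gen R (l 0%N)))]_y hw y)%E.
  by rewrite (ge0_integral_pushforward (mXn n m)).
transitivity (\int[pushforward P (X 0%N 0%N : T -> g_sigma_algebraType (@vec_gen R (l 0%N)))]_y hw y)%E.
  pose FX : {mfun T >-> g_sigma_algebraType (@vec_gen R (l 0%N))} :=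
    HB.pack (X n m : T -> g_sigma_algebraType (@vec_gen R (l 0%N))) (isMeasurableFun.Build _ _ _ _ _ (mXn n m)).
  pose FX0 : {mfun T >-> g_sigma_algebraType (@vec_gen R (l 0%N))} :=
    HB.pack (X 0%N 0%N : T -> g_sigma_algebraType (@vec_gen R (l 0%N))) (isMeasurableFun.Build _ _ _ _ _ (mXn 0%N 0%N)).
  apply: (@eq_measure_integral _ _ _ setT (distribution P FX0) (distribution P FX)) => B mB _.
  by case: HXiid => _ [_ ident]; exact: (ident (n, m) (0%N, 0%N) B mB).
by rewrite (ge0_integral_pushforward (mXn 0%N 0%N)).
Qed.

Let me_ n := fine (\int[P]_w (el n w)%:E)%E.

Lemma mean_pop_lossE n : (\int[P]_w (el n w)%:E)%E = (me_ n)%:E.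
Proof.
apply: (@integral_EFin_bounded _ _ _ _ _ Sb); first exact: measurable_pop_loss.
by move=> w; rewrite pop_loss_ge0 pop_loss_le.
Qed.

Lemma mean_pop_loss_ge0 n : 0 <= me_ n.
Proof.
rewrite -lee_fin -mean_pop_lossE; apply: integral_ge0 => w _.
by rewrite lee_fin pop_loss_ge0.
Qed.

Lemma mean_pop_loss_increment n : `|me_ n.+1 - me_ n| <= gamma n * K.
Proof.
have H n1 n2 : (forall w, `|el n1 w - el n2 w| <= gamma n * K) ->
    me_ n1 <= me_ n2 + gamma n * K.
  move=> h; rewrite -lee_fin EFinD -!mean_pop_lossE; apply: integral_le_addr => //.
  - exact: measurable_pop_loss.
  - exact: measurable_pop_loss.
  - by move=> w; exact: pop_loss_ge0.
  - by move=> w; exact: pop_loss_ge0.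
  - exact: K_ge0.
  by move=> w; have := le_trans (ler_norm _) (h w); lra.
have H1 := H n.+1 n (pop_loss_increment n).
have H2 : me_ n <= me_ n.+1 + gamma n * K.
  by apply: H => w; rewrite distrC; exact: pop_loss_increment.
by rewrite ler_norml; lra.
Qed.

Lemma measurable_sample_loss n m :
  measurable_fun [set: T] (fun w => sloss xi Rr (Theta n w) (X n m w)).
Proof. by apply: measurable_sloss => //; exact: mTheta. Qed.

Lemma integral_eloss n :
  (\int[P]_w (eloss xi Rr (Theta n w) (M n) (sample n w))%:E = (me_ n)%:E)%E.
Proof.
rewrite /eloss; under eq_integral do rewrite EFinM -sumEFin.
have ms i : measurable_fun [set: T]
    (fun w => (sloss xi Rr (Theta n w) (sample n w i))%:E).
  by apply/measurable_EFinP; exact: measurable_sample_loss.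
have s0 i w : [set: T] w -> (0 <= (sloss xi Rr (Theta n w) (sample n w i))%:E)%E.
  by rewrite lee_fin sloss_ge0.
have mS : measurable_fun [set: T]
    (fun w => (\sum_(i < M n) (sloss xi Rr (Theta n w) (sample n w i))%:E)%E).
  by apply: emeasurable_sum => i _; exact: ms.
have S0 w : [set: T] w ->
    (0 <= \sum_(i < M n) (sloss xi Rr (Theta n w) (sample n w i))%:E)%E.
  by move=> _; apply: sume_ge0 => i _; exact: s0.
have Mi0 : (0 <= ((M n)%:R^-1 : R)%:E)%E by rewrite lee_fin invr_ge0.
rewrite ge0_integralZl // ge0_integral_sum //; last by move=> i w; exact: s0.
rewrite (eq_bigr (fun=> (me_ n)%:E)); last first.
  by move=> i _; rewrite integral_sample_loss mean_pop_lossE.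
rewrite sumEFin -EFinM sumr_const card_ord -[X in _ * X]mulr_natl mulKf //.
by rewrite pnatr_eq0 -lt0n.
Qed.

(** The pathwise budget [r] is the same for all paths, so it survives integration; the mini-batch
    loss is unbiased by [integral_eloss]. *)
Lemma weighted_mean_loss n : \sum_(k < n) gamma k * me_ k <= r.
Proof.
rewrite -lee_fin -sumEFin.
have -> : (\sum_(k < n) (gamma k * me_ k)%:E =
   \int[P]_w \sum_(k < n) (gamma k * eloss xi Rr (Theta k w) (M k) (sample k w))%:E)%E.
  have me k : measurable_fun [set: T] (fun w => eloss xi Rr (Theta k w) (M k) (sample k w)).
    apply: measurable_funM; first exact: measurable_cst.
    by apply: measurable_sum => i; exact: measurable_sample_loss.
  rewrite ge0_integral_sum //=; last 2 first.
  - move=> k; apply/measurable_EFinP; apply: measurable_funM => //; exact: measurable_cst.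
  - by move=> k w _; rewrite lee_fin mulr_ge0 ?eloss_ge0.
  apply: eq_bigr => k _; under eq_integral do rewrite EFinM.
  rewrite ge0_integralZl //=; last 3 first.
  - exact/measurable_EFinP.
  - by move=> w _; rewrite lee_fin eloss_ge0.
  - by rewrite lee_fin.
  by rewrite integral_eloss EFinM.
have r0 : 0 <= r by have := sgd_bounded 0 point; have := nsq_ge0 (Theta 0%N point); lra.
have -> : r%:E = (\int[P]_w (cst r%:E w))%E.
  rewrite integral_cst // -[LHS]mule1; congr (_ * _)%E.
  exact/esym/probability_setT.
have me k : measurable_fun [set: T] (fun w => eloss xi Rr (Theta k w) (M k) (sample k w)).
  apply: measurable_funM; first exact: measurable_cst.
  by apply: measurable_sum => i; exact: measurable_sample_loss.
apply: ge0_le_integral => //=.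
- by move=> w _; apply: sume_ge0 => k _; rewrite lee_fin mulr_ge0 ?eloss_ge0.
- apply: emeasurable_sum => k; apply/measurable_EFinP.
  by apply: measurable_funM => //; exact: measurable_cst.
- by move=> w _; rewrite sumEFin lee_fin; exact: sgd_weighted_loss.
Qed.

(** Divergence provides a positive step size, and [gamma k * K] dominates an absolute value. *)
Lemma K_nonneg : 0 <= K.
Proof.
have [n Hn] := divergent_partial_sums g0 gdiv 0.
have [k gk] : exists k, 0 < gamma k.
  apply/not_existsP => H; move: Hn; rewrite big1 ?ltxx // => k _.
  by apply/eqP; rewrite eq_le g0 andbT leNgt; apply/negP; exact: H.
by have := K_ge0 k; rewrite pmulr_rge0.
Qed.

Lemma sgd_mean_cvg : me_ @ \oo --> (0 : R).
Proof.
exact: (weighted_vanishing g0 mean_pop_loss_ge0 K_nonneg gdiv weighted_mean_loss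
  mean_pop_loss_increment).
Qed.

(** The series of weighted population losses has mean at most [r], so it is finite almost surely; on
    that event [weighted_vanishing] applies path by path. *)
Lemma sgd_ae_cvg : {ae P, forall w, el ^~ w @ \oo --> (0 : R)}.
Proof.
pose S w := (\sum_(0 <= k <oo) (gamma k * el k w)%:E)%E.
have mt k : measurable_fun [set: T] (fun w => (gamma k * el k w)%:E).
  apply/measurable_EFinP; apply: measurable_funM; first exact: measurable_cst.
  exact: measurable_pop_loss.
have t0 k w : (0 <= (gamma k * el k w)%:E)%E by rewrite lee_fin mulr_ge0 ?pop_loss_ge0.
have IS : (\int[P]_w S w <= r%:E)%E.
  rewrite integral_nneseries //.
  apply: lime_le.
    by apply: is_cvg_nneseries => k _ _; apply: integral_ge0 => w _.
  near=> n; rewrite big_mkord.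
  apply: le_trans (_ : (\sum_(k < n) (gamma k * me_ k)%:E <= _)%E); last first.
    by rewrite sumEFin lee_fin weighted_mean_loss.
  apply: lee_sum => k _; under eq_integral do rewrite EFinM.
  rewrite ge0_integralZl //=.
  - by rewrite mean_pop_lossE EFinM.
  - by apply/measurable_EFinP; exact: measurable_pop_loss.
  - by move=> w _; rewrite lee_fin pop_loss_ge0.
  - by rewrite lee_fin.
have S0 w : (0 <= S w)%E by apply: nneseries_ge0.
have iS : P.-integrable setT S.
  apply/integrableP; split; first exact:
    (@ge0_emeasurable_sum _ _ _ _ _ xpredT (fun k w _ _ => t0 k w) (fun k _ => mt k)).
  under eq_integral do rewrite gee0_abs //.
  by apply: le_lt_trans IS _; exact: ltry.
have := integrable_ae measurableT iS.
apply: filterS => w /(_ I) Sfin.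
(* The budget [fine (S w)] depends on the path, which is harmless since the limit is taken for fixed
   [w]. *)
apply: (weighted_vanishing (C := K) (B := fine (S w)) g0 _ K_nonneg gdiv).
- by move=> n; exact: pop_loss_ge0.
- move=> n; rewrite -lee_fin fineK // -sumEFin.
  rewrite -(big_mkord xpredT (fun k => (gamma k * el k w)%:E)).
  exact: nneseries_lim_ge.
- by move=> n; exact: pop_loss_increment.
Unshelve. all: by end_near. Qed.

Lemma sgd_limsup_prob1 :
  P [set w | limn_esup (fun n => (pop_loss Rr xi P X (Theta n w))%:E) = 0%E] = 1%E.
Proof.
apply: ae_probability1; last first.
  by have := sgd_ae_cvg; apply: filterS => w H /=; exact: cvg_limn_esup_EFin.
have mL : measurable_fun [set: T] (fun w => limn_esup (fun n => (el n w)%:E)).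
  by apply: measurable_fun_limn_esup => n; apply/measurable_EFinP; exact: measurable_pop_loss.
by have := mL measurableT [set 0%E] (emeasurable_set1 _); rewrite setTI.
Qed.

Lemma sgd_limsup_mean :
  limn_esup (fun n => ('E_P[fun w => pop_loss Rr xi P X (Theta n w)])%E) = 0%E.
Proof.
under eq_fun do rewrite unlock mean_pop_lossE.
exact: cvg_limn_esup_EFin sgd_mean_cvg.
Qed.

End Sgd.

Theorem theorem1p1 (R : realType) (L dd : nat) (l : nat -> nat) (a b : R)
  (xi : 'cV[R]_(l L))
  (HL : (0 < L)%N) (Hl : forall k, (0 < l k)%N) (Hab : a < b)
  (Hdd : dd = (\sum_(1 <= k < L.+1) l k * (l k.-1 + 1))%N)
  (Rr : \bar R -> R -> R)
  (HRinf : forall y, Rr +oo%E y = Num.max y 0)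
  (HRC1 : forall r : R, 1 <= r ->
     (forall x, derivable (Rr r%:E) x 1) /\ continuous (derive1 (Rr r%:E)))
  (HR0 : forall r : R, 1 <= r -> forall x, x <= (2 * r)^-1 -> Rr r%:E x = 0)
  (HRle : forall r : R, 1 <= r -> forall y, 0 <= Rr r%:E y <= Num.max y 0)
  (HRid : forall r : R, 1 <= r -> forall z, r^-1 <= z -> Rr r%:E z = z)
  (HRder : exists K : R, forall r : R, 1 <= r -> forall x,
     `|derive1 (Rr r%:E) x| <= K)
  (dT : measure_display) (T : measurableType dT) (P : probability T R)
  (X : nat -> nat -> T -> 'cV[R]_(l 0%N))
  (HXiid : iid P (fun nm : nat * nat => X nm.1 nm.2))
  (HXab : forall n m w (i : 'I_(l 0%N)), a <= X n m w i ord0 <= b)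
  (M : nat -> nat) (HM : forall n, (0 < M n)%N)
  (G : nat -> 'cV[R]_dd -> T -> 'cV[R]_dd)
  (HG : forall n th w,
     cvg ((fun r : R => grad (fun t => emp_loss Rr xi M X n r%:E t w) th)
            @ +oo%R) ->
     G n th w = lim ((fun r : R => grad (fun t => emp_loss Rr xi M X n r%:E t w) th)
            @ +oo%R))
  (Theta : nat -> T -> 'cV[R]_dd) (gamma : nat -> R)
  (HTheta_meas : forall n, rvec_measurable (Theta n))
  (Hgamma0 : forall n, 0 <= gamma n)
  (Hindep : indep2 P (sigma_rv (Theta 0%N))
                     (sigma_family (fun nm : nat * nat => X nm.1 nm.2)))
  (Hupd : forall n w, Theta n.+1 w = Theta n w - gamma n *: G n (Theta n w) w)
  (Hstep : forall n w,
     (4 * L%:R * dd%:R * Num.max (Num.max `|a| `|b|) (Num.max (enorm xi) 1))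
       ^+ (2 * L) * gamma n <= ((enorm (Theta 0%N w) + 1) ^+ (2 * L))^-1)
  (Hdiv : (\sum_(0 <= k <oo) (gamma k)%:E)%E = +oo%E) :
  (exists C : R, P [set w | forall n, enorm (Theta n w) <= C] = 1%E) /\
  P [set w | limn_esup (fun n => (pop_loss Rr xi P X (Theta n w))%:E) = 0%E]
    = 1%E /\
  limn_esup (fun n => ('E_P[fun w => pop_loss Rr xi P X (Theta n w)])%E) = 0%E.

Proof.
set c := Num.max (Num.max `|a| `|b|) (Num.max (enorm xi) 1) in Hstep.
have HddE : dd = off l L.+1 by [].
have c1 : 1 <= c by rewrite /c !le_max lexx !orbT.
have xic : nsq xi <= c ^+ 2.
  rewrite -enorm_sqr lerXn2r ?nnegrE ?enorm_ge0 //; first by lra.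
  by rewrite /c !le_max lexx orbT.
have Xc n m w i : `|X n m w i ord0| <= c.
  have /andP[h1 h2] := HXab n m w i.
  have ac : `|a| <= c by rewrite /c !le_max lexx.
  have bc : `|b| <= c by rewrite /c !le_max lexx orbT.
  rewrite ler_norml; move: ac bc; rewrite !ler_norml => /andP[? ?] /andP[? ?].
  by apply/andP; split; lra.
have Theta_rec n w : Theta n.+1 w = Theta n w -
    gamma n *: ggrad xi Rr (Theta n w) (M n) (fun m => X n m.+1 w).
  have HRd (r : R) : 1 <= r -> forall x : R, derivable (Rr r%:E) x 1.
    by move=> r1; case: (HRC1 r r1).
  have G_cvg := @grad_emp_loss_cvg R l dd Rr HRinf HR0 HRle HRid HRd L xi dT T M X
    n (Theta n w) w.
  rewrite Hupd HG; last by apply/cvg_ex; eexists; exact: G_cvg.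
  by congr (_ - _ *: _); apply: cvg_lim => //; exact: norm_hausdorff.
have [r radr] := radius_bounded HL Hl HddE c1 Hgamma0 Hstep Hdiv.
split.
  (* The bound holds for every outcome, so the event is the whole space. *)
  exists (Num.sqrt r); rewrite [X in P X](_ : _ = setT) ?probability_setT //.
  rewrite -subTset => w _ n /=; apply: ler_wsqrtr.
  have := sgd_bounded HL Hl HddE HRinf c1 xic Xc HM Hgamma0 Theta_rec Hstep radr n w.
  by rewrite /nsq; lra.
split.
  exact: (sgd_limsup_prob1 HL Hl HddE HRinf HXiid c1 xic Xc HM (HTheta_meas 0%N)
    Hgamma0 Hindep Theta_rec Hstep Hdiv radr).
exact: (sgd_limsup_mean HL Hl HddE HRinf HXiid c1 xic Xc HM (HTheta_meas 0%N)
  Hgamma0 Hindep Theta_rec Hstep Hdiv radr).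
Qed.
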